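(* Let $\rho\ge2$, $d=\rho-1$. For every $C\in\mathcal{C}_{\Pi_d}^\rho$ the checkerboard approximation $\mathfrak{CB}_N(C)$ of $C$ converges to $C$ with respect to the metric $D_1$, i.e., $$\lim_{N\to\infty}D_1(\mathfrak{CB}_N(C),C)=0.$$
   Context: $\mathcal{C}^\rho$ is the set of $\rho$-dimensional copulas; $\mu_C$ is the probability measure on $[0,1]^\rho$ with distribution function $C$. $\mathcal{C}^\rho_{\Pi_d}=\{C\in\mathcal{C}^\rho:\ C(x_1,\ldots,x_d,1)=\prod_{i=1}^d x_i \text{ for all } x_1,\ldots,x_d\in[0,1]\}$ is the set of linkages. $\lambda^d$ is $d$-dimensional Lebesgue measure, $\lambda=\lambda^1$. For $C\in\mathcal{C}^\rho_{\Pi_d}$, $K_C:[0,1]^d\times\mathcal{B}([0,1])\to[0,1]$ is (a version of) the Markov kernel of the last coordinate given the first $d$ coordinates: $\mu_C(E\times F)=\int_E K_C(\boldsymbol{x},F)\,d\lambda^d(\boldsymbol{x})$ for Borel $E,F$. For linkages $A,B\in\mathcal{C}^\rho_{\Pi_d}$, $$D_1(A,B)=\int_{[0,1]}\int_{[0,1]^d}|K_A(\boldsymbol{x},[0,y])-K_B(\boldsymbol{x},[0,y])|\,d\lambda^d(\boldsymbol{x})\,d\lambda(y).$$ For $A\in\mathcal{C}^\rho$ and $N\in\mathbb{N}$, the $N$-checkerboard approximation $\mathfrak{CB}_N(A)$ is the absolutely continuous copula with density $N^\rho\sum_{\boldsymbol{i},j}\mu_A\big(R_N^{\boldsymbol{i}}\times[\frac{j-1}{N},\frac{j}{N}]\big)\mathbf{1}_{R_N^{\boldsymbol{i}}\times[\frac{j-1}{N},\frac{j}{N}]}$,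 the sum over $\boldsymbol{i}\in\{1,\ldots,N\}^d$, $j\in\{1,\ldots,N\}$, where $R_N^{\boldsymbol{i}}=[\frac{i_1-1}{N},\frac{i_1}{N}]\times\cdots\times[\frac{i_d-1}{N},\frac{i_d}{N}]$. If $C\in\mathcal{C}^\rho_{\Pi_d}$ then $\mathfrak{CB}_N(C)\in\mathcal{C}^\rho_{\Pi_d}$. *)

(* Defs.v *)
From HB Require Import structures.
From mathcomp Require Import all_boot all_order all_algebra.
From mathcomp Require Import all_classical all_reals all_analysis.
Set Implicit Arguments.
Unset Strict Implicit.
Unset Printing Implicit Defensive.
Import Order.TTheory GRing.Theory Num.Theory.
Import numFieldNormedType.Exports.
Local Open Scope classical_set_scope.
Local Open Scope ring_scope.

(* Euclidean space R^n, with the product (= Borel) sigma-algebra. *)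
Notation euclid R n := (n.-tuple (measurableTypeR R)).

Section Euclid.
Variable R : realType.

(* R^d * R -> R^(d.+1): the new coordinate is the last one. *)
Definition tsnoc d (p : euclid R d * measurableTypeR R) : euclid R d.+1 :=
  [tuple of rcons p.1 p.2].

Lemma tnth_tsnoc_widen d (p : euclid R d * measurableTypeR R) (i : 'I_d) :
  tnth (tsnoc p) (widen_ord (leqnSn d) i) = tnth p.1 i.
Proof.
rewrite (tnth_nth point) /= nth_rcons size_tuple ltn_ord.
by rewrite -tnth_nth.
Qed.

Lemma tnth_tsnoc_max d (p : euclid R d * measurableTypeR R) :
  tnth (tsnoc p) ord_max = p.2.
Proof. by rewrite (tnth_nth point) /= nth_rcons size_tuple ltnn eqxx. Qed.

Lemma measurable_tsnoc d : measurable_fun setT (@tsnoc d).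
Proof.
apply/measurable_fun_tnthP => i.
have [id|di] := ltnP i d.
  rewrite (_ : _ \o _ = (fun t => tnth t (Ordinal id)) \o fst).
    apply: measurableT_comp; last exact: measurable_fst.
    exact: measurable_tnth.
  apply/funext => p /=; rewrite -tnth_tsnoc_widen.
  by congr tnth; exact: val_inj.
rewrite (_ : _ \o _ = snd); first exact: measurable_snd.
apply/funext => p /=; rewrite -[RHS]tnth_tsnoc_max.
congr tnth; apply: val_inj => /=; apply/eqP.
by rewrite eqn_leq di -ltnS ltn_ord.
Qed.

Definition lebesgue_snoc d (mu : {measure set (euclid R d) -> \bar R}) :
    set (euclid R d.+1) -> \bar R :=
  pushforward (mu \x @lebesgue_measure R)%E (@tsnoc d).

Section lebesgue_snoc_measure.
Variables (d : nat) (mu : {measure set (euclid R d) -> \bar R}).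

Let lebesgue_snoc0 : lebesgue_snoc mu set0 = 0%E.
Proof. by rewrite /lebesgue_snoc /pushforward preimage_set0 measure0. Qed.

Let lebesgue_snoc_ge0 A : (0 <= lebesgue_snoc mu A)%E.
Proof. by rewrite /lebesgue_snoc /pushforward; exact: measure_ge0. Qed.

Let lebesgue_snoc_sigma_additive : semi_sigma_additive (lebesgue_snoc mu).
Proof.
exact: (@measure_semi_sigma_additive _ _ _
  (measure_function_pushforward__canonical__measure_function_Measure
     (mu \x @lebesgue_measure R)%E (@measurable_tsnoc d))).
Qed.

HB.instance Definition _ := isMeasure.Build _ _ _ (lebesgue_snoc mu)
  lebesgue_snoc0 lebesgue_snoc_ge0 lebesgue_snoc_sigma_additive.

End lebesgue_snoc_measure.

(* n-dimensional Lebesgue measure: lambda^0 is the unit mass on the one-point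
   space and lambda^(n+1) is the product lambda^n \x lambda. *)
Fixpoint lebesgue_euclid n : {measure set (euclid R n) -> \bar R} :=
  match n with
  | 0 => \d_([tuple] : euclid R 0)
  | m.+1 => lebesgue_snoc (lebesgue_euclid m)
  end.

End Euclid.

Section Copulas.
Variable R : realType.

Definition cube n : set (euclid R n) :=
  [set x | forall i, (0 <= tnth x i :> R) && (tnth x i <= 1 :> R)].
Arguments cube n : clear implicits.

(* [0, x_1] * ... * [0, x_n] *)
Definition lower_box n (x : euclid R n) : set (euclid R n) :=
  [set t | forall i, (0 <= tnth t i :> R) && (tnth t i <= tnth x i :> R)].

(* P is a probability measure on [0,1]^n with distribution function C.  Only
   the restriction of C to [0,1]^n is meaningful. *)
Definition has_distribution_function n (P : probability (euclid R n) R)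
    (C : euclid R n -> R) :=
  P (cube n) = 1%E /\
  forall x, cube n x -> P (lower_box x) = (C x)%:E.

(* An n-dimensional copula is a distribution function on [0,1]^n with uniform
   one-dimensional margins. *)
Definition is_copula n (C : euclid R n -> R) :=
  (exists P, has_distribution_function P C) /\
  forall (i : 'I_n) (u : R), 0 <= u <= 1 ->
    C [tuple (if j == i then u else 1) | j < n] = u.

(* mu_C; an irrelevant Dirac mass if C is not a distribution function. *)
Definition copula_measure n (C : euclid R n -> R) :
    probability (euclid R n) R :=
  @xget {classic probability (euclid R n) R} (@dirac _ (euclid R n) point R)
    [set P | has_distribution_function P C].

(* Here rho = d + 1 and the last coordinate is the one singled out. *)
Definition is_linkage d (C : euclid R d.+1 -> R) :=
  is_copula C /\
  forall x : euclid R d, cube d x ->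
    C (tsnoc (x, 1)) = \prod_(i < d) (tnth x i : R).

(* K is a version of the Markov kernel of the last coordinate given the first
   d ones.  K is given on all of R^d, only its restriction to [0,1]^d matters,
   where it has to be carried by [0,1]. *)
Definition is_markov_kernel d (C : euclid R d.+1 -> R)
    (K : R.-pker (euclid R d) ~> measurableTypeR R) :=
  (forall x, cube d x -> K x `[0, 1]%classic = 1%E) /\
  forall (E : set (euclid R d)) (F : set (measurableTypeR R)),
    measurable E -> E `<=` cube d -> measurable F -> F `<=` `[0, 1]%classic ->
    copula_measure C (@tsnoc R d @` (E `*` F)) =
    (\int[lebesgue_euclid R d]_(x in E) K x F)%E.

(* K_C; an irrelevant constant kernel if there is no such version. *)
Definition markov_kernel d (C : euclid R d.+1 -> R) :
    R.-pker (euclid R d) ~> measurableTypeR R :=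
  @xget {classic R.-pker (euclid R d) ~> measurableTypeR R}
    (kdirac (measurable_cst (point : measurableTypeR R)))
    [set K | is_markov_kernel C K].

Definition D1 d (A B : euclid R d.+1 -> R) : \bar R :=
  (\int[@lebesgue_measure R]_(y in `[0%R, 1%R])
   \int[lebesgue_euclid R d]_(x in cube d)
     `|markov_kernel A x `[0%R, y]%classic -
       markov_kernel B x `[0%R, y]%classic|)%E.

(* The grid indices are 0-based: the k-th side is [i_k / N, (i_k + 1) / N]. *)
Definition cell n N (i : n.-tuple 'I_N) : set (euclid R n) :=
  [set t | forall k, ((tnth i k)%:R / N%:R <= tnth t k :> R) &&
                     (tnth t k <= (tnth i k).+1%:R / N%:R :> R)].

Definition checkerboard_density n N (A : euclid R n -> R) (t : euclid R n) :
    \bar R :=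
  ((N ^ n)%:R%:E *
   \sum_(i : n.-tuple 'I_N) copula_measure A (cell i) * (\1_(cell i) t)%:E)%E.

(* CB_N(A), as the distribution function of the density above; it is a copula
   for N >= 1. *)
Definition checkerboard n N (A : euclid R n -> R) (x : euclid R n) : R :=
  fine (\int[lebesgue_euclid R n]_(t in lower_box x)
          checkerboard_density N A t)%E.

End Copulas.

(* Main.v *)
Require Import Defs.
From HB Require Import structures.
From mathcomp Require Import all_boot all_order all_algebra.
From mathcomp Require Import all_classical all_reals all_analysis.
From mathcomp Require Import measurable_realfun ring lra zify.
Import numFieldNormedType.Exports.
Set Implicit Arguments.
Unset Strict Implicit.
Unset Printing Implicit Defensive.
Import Order.TTheory GRing.Theory Num.Theory.
Local Open Scope classical_set_scope.
Local Open Scope ring_scope.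

(* Disintegration turns a linkage C into the distribution functions
   f_y(x) = K_C(x, [0,y]), and the checkerboard approximation into the function
   that is constant on each cell of [0,1]^d and there equals, up to interpolation
   in y, the mean of f_y over the cell. The interpolation costs at most 1/N in L^1,
   since the last margin is uniform. Replacing f_y by its cell means is a
   contraction of L^1 fixing the cellwise constant functions, so the cell means
   converge to f_y because f_y is an L^1 limit of cellwise constant functions: the
   sets that unions of cells approximate form a sigma-algebra containing the boxes.
   Convergence is uniform in y because f_y is monotone in y. The kernel K_C itself
   is the law of a conditional quantile of a uniform variable. *)

(** * Coordinates and boxes *)

(** [copula_measure] and [markov_kernel] are choices with irrelevant default values, so nothing is
    known about them until a suitable measure or kernel is shown to exist. This is why a
    disintegration has to be constructed. Afterwards a kernel is used only as a probability for each
    x whose integrals over cells are known; these integrals fix it up to null sets. The grids of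
    different sizes are not nested, so a martingale argument does not cover the full sequence of N.
    Approximation by unions of cells is therefore demanded for every large grid, not just for one.
    The cells in the checkerboard density are closed and overlap in their faces. The proof works
    with half-open cells that partition the cube; the faces are null both for Lebesgue measure and
    for every copula. Grid sizes are written [M.+1], which keeps N = 0 out. *)

Definition tinit T n (t : n.+1.-tuple T) : n.-tuple T :=
  [tuple tnth t (widen_ord (leqnSn n) i) | i < n].

Definition tlast T n (t : n.+1.-tuple T) : T := tnth t ord_max.

Section Coordinates.
Variable R : realType.

Lemma tinitK n (p : euclid R n * measurableTypeR R) : tinit (tsnoc p) = p.1.
Proof. by apply: eq_from_tnth => i; rewrite tnth_mktuple tnth_tsnoc_widen. Qed.

Lemma tlastK n (p : euclid R n * measurableTypeR R) : tlast (tsnoc p) = p.2.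
Proof. exact: tnth_tsnoc_max. Qed.

Lemma ord_lastP n (P : 'I_n.+1 -> Prop) :
  (forall i : 'I_n, P (widen_ord (leqnSn n) i)) -> P ord_max -> forall i, P i.
Proof.
move=> Pw Pm i; have [lt_in|ge_in] := ltnP i n.
  have := Pw (Ordinal lt_in); congr (P _); exact: val_inj.
suff -> : i = ord_max by [].
by apply: val_inj; apply/eqP; rewrite eqn_leq ge_in andbT -ltnS ltn_ord.
Qed.

Lemma tsnocK n (t : euclid R n.+1) : tsnoc (tinit t, tlast t) = t.
Proof.
apply: eq_from_tnth; apply: ord_lastP => [i|].
  by rewrite tnth_tsnoc_widen tnth_mktuple.
by rewrite tnth_tsnoc_max.
Qed.

Lemma measurable_tinit n : measurable_fun setT (@tinit (measurableTypeR R) n).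
Proof.
apply/measurable_fun_tnthP => i.
rewrite (_ : _ \o _ = @tnth _ _ ^~ (widen_ord (leqnSn n) i)).
  exact: measurable_tnth.
by apply/funext => t /=; rewrite tnth_mktuple.
Qed.

Lemma measurable_tlast n : measurable_fun setT (@tlast (measurableTypeR R) n).
Proof. exact: measurable_tnth. Qed.

Definition tprod n (E : set (euclid R n)) (F : set (measurableTypeR R)) :
  set (euclid R n.+1) := (@tinit _ n @^-1` E) `&` (@tlast _ n @^-1` F).

Lemma tsnoc_image n (E : set (euclid R n)) (F : set (measurableTypeR R)) :
  @tsnoc R n @` (E `*` F) = tprod E F.
Proof.
apply/seteqP; split=> [_ [p [Ep Fp]] <-|t [Et Ft]].
  by split; rewrite /= ?tinitK ?tlastK.
by exists (tinit t, tlast t) => //; exact: tsnocK.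
Qed.

Lemma measurable_tprod n E F : measurable E -> measurable F ->
  measurable (@tprod n E F).
Proof.
move=> mE mF; apply: measurableI; rewrite -[_ @^-1` _]setTI.
  exact: measurable_tinit.
exact: measurable_tlast.
Qed.

Lemma lebesgue_tprod n E F : measurable E -> measurable F ->
  lebesgue_euclid R n.+1 (@tprod n E F) =
  (lebesgue_euclid R n E * @lebesgue_measure R F)%E.
Proof.
move=> mE mF; rewrite -product_measure1E//=.
rewrite /lebesgue_snoc /pushforward; congr (_ _).
by apply/seteqP; split=> p /=; rewrite /tprod /= tinitK tlastK.
Qed.

Definition box n (A : 'I_n -> set (measurableTypeR R)) : set (euclid R n) :=
  [set t | forall i, A i (tnth t i)].

Lemma measurable_box n (A : 'I_n -> set (measurableTypeR R)) :
  (forall i, measurable (A i)) -> measurable (box A).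
Proof.
move=> mA; rewrite (_ : box A = \bigcap_i (@tnth n _ ^~ i @^-1` A i)).
  apply: fin_bigcap_measurable => // i _.
  by rewrite -[_ @^-1` _]setTI; exact: measurable_tnth.
by apply/seteqP; split=> t; [move=> At i _; exact: At|move=> At i; exact: At].
Qed.

Lemma boxS n (A : 'I_n.+1 -> set (measurableTypeR R)) :
  box A = tprod (box (fun i => A (widen_ord (leqnSn n) i))) (A ord_max).
Proof.
apply/seteqP; split=> [t At|t [At1 At2]].
  split=> [i|] /=; last exact: At.
  by rewrite tnth_mktuple; exact: At.
by apply: ord_lastP => // i; have := At1 i; rewrite tnth_mktuple.
Qed.

Lemma lebesgue_box n (A : 'I_n -> set (measurableTypeR R)) (a : 'I_n -> R) :
  (forall i, measurable (A i)) ->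
  (forall i, @lebesgue_measure R (A i) = (a i)%:E) ->
  lebesgue_euclid R n (box A) = (\prod_i a i)%:E.
Proof.
elim: n A a => [|n IH] A a mA aE.
  rewrite big_ord0 /= diracE mem_set//; by move=> [].
rewrite boxS lebesgue_tprod//; last exact: measurable_box.
by rewrite (IH _ (fun i => a (widen_ord _ i)))// aE big_ord_recr EFinM.
Qed.

Lemma cubeE n : @cube R n = box (fun=> `[0, 1]%classic).
Proof.
by apply/seteqP; split=> t + i => /(_ i) /=; rewrite in_itv.
Qed.

Lemma measurable_cube n : measurable (@cube R n).
Proof. by rewrite cubeE; exact: measurable_box. Qed.

Lemma lebesgue_itv01 : @lebesgue_measure R `[0, 1]%classic = 1%:E.
Proof. by rewrite lebesgue_measure_itv/= lte01 oppr0 adde0. Qed.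

Lemma lebesgue_cube n : lebesgue_euclid R n (@cube R n) = 1%E.
Proof.
rewrite cubeE (@lebesgue_box _ _ (fun=> 1))//; first by rewrite big1.
by move=> _; exact: lebesgue_itv01.
Qed.

Lemma cubeS n : @cube R n.+1 = tprod (@cube R n) `[0, 1]%classic.
Proof. by rewrite !cubeE boxS. Qed.

Lemma lower_boxE n (x : euclid R n) :
  lower_box x = box (fun i => `[0, tnth x i]%classic).
Proof.
by apply/seteqP; split=> t + i => /(_ i) /=; rewrite in_itv.
Qed.

Lemma measurable_lower_box n (x : euclid R n) : measurable (lower_box x).
Proof. by rewrite lower_boxE; exact: measurable_box. Qed.

Lemma lebesgue_lower_box n (x : euclid R n) : @cube R n x ->
  lebesgue_euclid R n (lower_box x) = (\prod_i (tnth x i : R))%:E.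
Proof.
move=> cx; rewrite lower_boxE (@lebesgue_box _ _ (fun i => tnth x i))// => i.
rewrite lebesgue_measure_itv/= lte_fin oppr0 adde0.
have /andP[] := cx i; rewrite le_eqVlt => /orP[/eqP <- _|->//].
by rewrite ltxx.
Qed.

End Coordinates.

Lemma measure_setI_full d (T : measurableType d) (R : realType)
    (m : {measure set T -> \bar R}) (D A : set T) :
  measurable D -> measurable A -> m (~` D) = 0%E -> m (A `&` D) = m A.
Proof.
move=> mD mA mD0; rewrite (measureDI m mA mD) [X in _ = (X + _)%E](_ : _ = 0%E) ?add0e//.
apply: (@subset_measure0 _ _ _ m _ (~` D)) => //.
- exact: measurableD.
- exact: measurableC.
Qed.

(** * Uniqueness of measures carried by the cube *)

Section LowerBoxUnique.
Variable R : realType.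

(** Lower boxes start at 0, so they cannot generate the Borel sets of the whole space. Quadrants do,
    are closed under intersection, and exhaust the space along the corners (k, ..., k). *)
Definition quadrant n (x : euclid R n) : set (euclid R n) :=
  box (fun i => `]-oo, tnth x i]%classic).

Definition quadrants n : set (set (euclid R n)) := range (@quadrant n).

Lemma quadrantP n (x t : euclid R n) :
  quadrant x t <-> forall i, (tnth t i : R) <= tnth x i.
Proof. by split=> + i => /(_ i); rewrite /= in_itv. Qed.

Lemma setI_closed_quadrants n : setI_closed (@quadrants n).
Proof.
move=> _ _ [x _ <-] [y _ <-].
exists [tuple (Order.min (tnth x i : R) (tnth y i) : measurableTypeR R) | i < n] => //.
apply/seteqP; split=> t.
  by move/quadrantP => xyt; split; apply/quadrantP => i; have := xyt i;
    rewrite tnth_mktuple le_min => /andP[].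
move=> [/quadrantP xt /quadrantP yt]; apply/quadrantP => i.
by rewrite tnth_mktuple le_min xt yt.
Qed.

Lemma quadrant_cover n :
  \bigcup_k quadrant [tuple (k%:R : measurableTypeR R) | _ < n] = setT.
Proof.
apply/seteqP; split=> // t _.
exists (\sum_(i < n) (Num.truncn (`|tnth t i : R|)).+1)%N => //.
apply/quadrantP => i; rewrite tnth_mktuple.
apply: (le_trans (ler_norm _)); apply/ltW.
apply: (lt_le_trans (truncnS_gt _)); rewrite ler_nat.
by rewrite (bigD1 i)//= leq_addr.
Qed.

Lemma measurable_quadrant n (x : euclid R n) : measurable (quadrant x).
Proof. exact: measurable_box. Qed.

Lemma measurable_quadrants n :
  @measurable _ (euclid R n) = <<s @quadrants n >>.
Proof.
apply/seteqP; split; last first.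
  apply: smallest_sub; first exact: sigma_algebra_measurable.
  by move=> _ [x _ <-]; exact: measurable_quadrant.
suff mid : measurable_fun setT
    (idfun : g_sigma_algebraType (@quadrants n) -> euclid R n).
  by move=> A mA; have := mid measurableT A mA; rewrite setTI.
apply/measurable_fun_tnthP => i.
apply: (measurability _ (RGenOInfty.measurableE R)) => //.
move=> _ [_ [a ->] <-]; rewrite setTI.
(* The half-space where the i-th coordinate is at most a is the increasing union of the quadrants
   whose corner has i-th coordinate a and all others equal to k. *)
rewrite (_ : _ @^-1` _ = ~` \bigcup_k quadrant
    [tuple (if j == i then a else k%:R : measurableTypeR R) | j < n]).
  apply: measurableC; apply: bigcupT_measurable => k.
  by apply: sub_sigma_algebra; eexists.
apply/seteqP; split=> t /=; rewrite in_itv /= andbT.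
  move=> at_ [k _ /quadrantP/(_ i)].
  by rewrite tnth_mktuple eqxx leNgt at_.
move=> nt; rewrite ltNge; apply/negP => ta; apply: nt.
have : [set: euclid R n] t by [].
rewrite -quadrant_cover => -[k _ /quadrantP kt]; exists k => //.
apply/quadrantP => j; rewrite tnth_mktuple; case: eqVneq => [->//|_].
by have := kt j; rewrite tnth_mktuple.
Qed.

Lemma quadrant_cube n (x : euclid R n) :
  quadrant x `&` @cube R n = set0 \/
  exists2 y, @cube R n y & quadrant x `&` @cube R n = lower_box y.
Proof.
have [x0|/existsNP[i /negP]] := pselect (forall i, 0 <= (tnth x i : R)).
  right; exists [tuple (Order.min (tnth x i : R) 1 : measurableTypeR R) | i < n].
    by move=> i; rewrite tnth_mktuple le_min x0 ler01 ge_min lexx orbT.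
  apply/seteqP; split=> t.
    move=> [/quadrantP xt ct] i; rewrite tnth_mktuple le_min xt.
    by have /andP[-> ->] := ct i.
  move=> lt; split; [apply/quadrantP|]=> i; have := lt i.
    by rewrite tnth_mktuple le_min => /and3P[].
  by rewrite tnth_mktuple le_min => /and3P[-> _ ->].
rewrite -ltNge => xi; left; apply/seteqP; split=> // t [/quadrantP/(_ i) xt].
by move=> /(_ i)/andP[/le_trans/(_ xt)]; rewrite leNgt xi.
Qed.

(** Both measures live on the cube, and a quadrant meets the cube in a lower box or not at all.
    Agreement on lower boxes thus passes to the quadrants, a generating pi-system that covers the
    space by sets of finite measure. *)
Lemma lower_box_measure_unique n (m1 m2 : {measure set (euclid R n) -> \bar R}) :
  m1 (~` @cube R n) = 0%E -> m2 (~` @cube R n) = 0%E ->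
  (m1 (@cube R n) < +oo)%E ->
  (forall x, @cube R n x -> m1 (lower_box x) = m2 (lower_box x)) ->
  forall E, measurable E -> m1 E = m2 E.
Proof.
move=> m10 m20 m1oo m12 E mE.
have mc := @measurable_cube R n.
apply: (measure_unique (@quadrants n)
  (fun k => quadrant [tuple (k%:R : measurableTypeR R) | _ < n])) => //.
- exact: measurable_quadrants.
- exact: setI_closed_quadrants.
- by move=> k; eexists.
- exact: quadrant_cover.
- move=> _ [x _ <-]; have mx := measurable_quadrant x.
  rewrite -(measure_setI_full mc mx m10) -(measure_setI_full mc mx m20).
  have [->|[y cy ->]] := quadrant_cube x; first by rewrite !measure0.
  exact: m12.
- move=> k; rewrite -(measure_setI_full mc (measurable_quadrant _) m10).
  apply: le_lt_trans m1oo; apply: le_measure; rewrite ?inE//.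
  by apply: measurableI => //; exact: measurable_quadrant.
Qed.

End LowerBoxUnique.

Section Generic.
Context d (T : measurableType d) (R : realType).
Variable m : {measure set T -> \bar R}.

Lemma le_measureW (A B : set T) : measurable A -> measurable B -> A `<=` B ->
  (m A <= m B)%E.
Proof. by move=> mA mB AB; apply: le_measure; rewrite ?inE. Qed.

(* The library version asks for measurable integrands, which the integral, a
   supremum over simple functions, does not need. *)
Lemma ge0_le_integralW (D : set T) (f g : T -> \bar R) :
  (forall x, D x -> 0 <= f x)%E -> (forall x, D x -> f x <= g x)%E ->
  (\int[m]_(x in D) f x <= \int[m]_(x in D) g x)%E.
Proof.
move=> f0 fg; rewrite !ge0_integralE//; last first.
  by move=> x Dx; exact: le_trans (f0 _ Dx) (fg _ Dx).
apply: le_ereal_sup => _ [h /= hf <-]; exists h => // x /=.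
apply: le_trans (hf x) _; rewrite /patch; case: ifPn => //.
by rewrite inE => /fg.
Qed.

Lemma measure_bigsetU_le (I : Type) (s : seq I) (P : pred I) (A : I -> set T) :
  (forall i, measurable (A i)) ->
  (m (\big[setU/set0]_(i <- s | P i) A i) <= \sum_(i <- s | P i) m (A i))%E.
Proof.
move=> mA; elim: s => [|i s IH]; first by rewrite !big_nil measure0.
rewrite !big_cons; case: ifP => // _; apply: le_trans (measureU2 _ _ _) _ => //.
  exact: bigsetU_measurable.
exact: leeD2l.
Qed.

Lemma measure_disjoint_bigsetU (I : choiceType) (s : seq I) (P : pred I)
    (A : I -> set T) :
  uniq s -> (forall i, measurable (A i)) ->
  (forall i j, A i `&` A j !=set0 -> i = j) ->
  m (\big[setU/set0]_(i <- s | P i) A i) = (\sum_(i <- s | P i) m (A i))%E.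
Proof.
move=> + mA dA; elim: s => [|i s IH] /=; first by rewrite !big_nil measure0.
move=> /andP[is_ us]; rewrite !big_cons; case: ifP => _; last exact: IH.
rewrite -IH//; apply: measureU => //.
  exact: bigsetU_measurable.
apply/seteqP; split=> // x [Aix]; rewrite -bigcup_seq_cond => -[j /= /andP[js _] Ajx].
by move: is_; rewrite (dA i j) ?js//; exists x.
Qed.

End Generic.

(** * Cells and cellwise approximation *)

Section Codes.
Variable R : realType.
Implicit Types M n : nat.

(** The cap at [M] puts t = 1 into the last slab, and [Num.truncn] sends negative numbers to 0, so
    the code is monotone on the whole line. *)
Definition code1 M (t : R) : 'I_M.+1 :=
  inord (minn M (Num.truncn (M.+1%:R * t))).

Lemma val_code1 M (t : R) : code1 M t = minn M (Num.truncn (M.+1%:R * t)) :> nat.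
Proof. by rewrite inordK// ltnS geq_minl. Qed.

Lemma code1_mono M (t u : R) : t <= u -> (code1 M t <= code1 M u)%N.
Proof.
move=> tu; rewrite !val_code1 leq_min geq_minl/=.
apply: leq_trans (geq_minr _ _) _; apply: le_truncn.
by rewrite ler_pM2l// ltr0n.
Qed.

(* Half-open except for the last one, so that the slabs partition [0, 1]. *)
Definition slab M (j : 'I_M.+1) : set (measurableTypeR R) :=
  [set` Interval (BLeft (j%:R / M.+1%:R)) (BSide (j < M)%N (j.+1%:R / M.+1%:R))].

Lemma slabP M (j : 'I_M.+1) (t : R) :
  slab j t <-> 0 <= t <= 1 /\ code1 M t = j.
Proof.
have M0 : 0 < M.+1%:R :> R by rewrite ltr0n.
have jM : (j <= M)%N by rewrite -ltnS.
have eL : (j%:R / M.+1%:R <= t) = (j%:R <= M.+1%:R * t).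
  by rewrite ler_pdivrMr// mulrC.
have eR : (t < j.+1%:R / M.+1%:R) = (M.+1%:R * t < j.+1%:R).
  by rewrite ltr_pdivlMr// mulrC.
rewrite /slab /= itv_boundlr/= !bnd_simp eL.
have [jltM|jgeM] := ltnP j M; rewrite /= ?bnd_simp.
  rewrite eR; split.
    move=> /andP[jt tj]; have t0 : 0 <= t.
      by rewrite -(pmulr_rge0 _ M0) (le_trans _ jt).
    split.
      rewrite t0 -(ler_pM2l M0) mulr1 (le_trans (ltW tj))// ler_nat.
      by rewrite ltnS.
    apply: val_inj; rewrite /= val_code1 (truncn_def (n := j)) ?jt//.
    exact/minn_idPr.
  move=> [/andP[t0 t1]] cj; have := val_code1 M t; rewrite cj => ej.
  have {}ej : j = Num.truncn (M.+1%:R * t) :> nat by move: ej; rewrite /minn; case: ifP; lia.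
  by rewrite ej; apply: truncn_itv; rewrite mulr_ge0// ltW.
have -> : nat_of_ord j = M by lia.
rewrite divff ?gt_eqF//; split.
  move=> /andP[jt t1]; split.
    by rewrite t1 andbT -(pmulr_rge0 _ M0) (le_trans _ jt).
  apply: val_inj; rewrite /= val_code1.
  have /minn_idPl -> : (M <= Num.truncn (M.+1%:R * t))%N.
    by rewrite truncn_ge_nat// (le_trans _ jt).
  lia.
move=> [/andP[t0 ->]] cj; rewrite andbT.
rewrite -truncn_ge_nat; last by rewrite mulr_ge0// ltW.
by have := val_code1 M t; rewrite cj /minn; case: ifP; lia.
Qed.

Lemma measurable_slab M (j : 'I_M.+1) : measurable (slab j).
Proof. exact: measurable_itv. Qed.

Lemma lebesgue_slab M (j : 'I_M.+1) :
  @lebesgue_measure R (slab j) = (M.+1%:R^-1)%:E.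
Proof.
have M0 : 0 < M.+1%:R :> R by rewrite ltr0n.
rewrite lebesgue_measure_itv /= lte_fin ltr_pM2r ?invr_gt0// ltr_nat ltnSn.
by rewrite -EFinB -mulrBl -natrB// subSnn mul1r.
Qed.

Definition code M n (t : euclid R n) : n.-tuple 'I_M.+1 :=
  [tuple code1 M (tnth t k : R) | k < n].

(** Half-open counterpart of [cell]: these sets partition the cube, so every point of the cube lies
    in exactly the one named by its code. [measure_cell] justifies the exchange. *)
Definition pcell M n (i : n.-tuple 'I_M.+1) : set (euclid R n) :=
  box (fun k => slab (tnth i k)).

Lemma pcellP M n (i : n.-tuple 'I_M.+1) (t : euclid R n) :
  pcell i t <-> cube t /\ code M t = i.
Proof.
split=> [it|[ct <-] k].
  split=> [k|]; first by have /slabP[] := it k.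
  by apply: eq_from_tnth => k; rewrite tnth_mktuple; have /slabP[] := it k.
by rewrite tnth_mktuple; apply/slabP; split=> //; exact: ct.
Qed.

Lemma measurable_pcell M n (i : n.-tuple 'I_M.+1) : measurable (pcell i).
Proof. by apply: measurable_box => k; exact: measurable_slab. Qed.

Lemma lebesgue_pcell M n (i : n.-tuple 'I_M.+1) :
  lebesgue_euclid R n (pcell i) = ((M.+1 ^ n)%:R^-1)%:E.
Proof.
rewrite (@lebesgue_box _ _ _ (fun=> M.+1%:R^-1)).
- by rewrite prodr_const card_ord exprVn natrX.
- by move=> k; exact: measurable_slab.
- by move=> k; exact: lebesgue_slab.
Qed.

Lemma pcell_inj M n (i j : n.-tuple 'I_M.+1) : pcell i `&` pcell j !=set0 -> i = j.
Proof. by move=> [t [/pcellP[_ it] /pcellP[_ jt]]]; rewrite -it -jt. Qed.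

Lemma cube_codeE M n (U : pred (n.-tuple 'I_M.+1)) :
  [set t | @cube R n t /\ U (code M t)] = \big[setU/set0]_(i | U i) pcell i.
Proof.
rewrite -bigcup_seq_cond; apply/seteqP; split=> t.
  by move=> [ct Ut]; exists (code M t); [rewrite /= mem_index_enum|apply/pcellP].
by move=> [i /= /andP[_ Ui]] /pcellP[ct ci]; split=> //; rewrite ci.
Qed.

End Codes.

Section Approximation.
Variables (R : realType) (n : nat).
Local Notation leb := (lebesgue_euclid R n).
Local Notation cube := (@cube R n).

Definition mismatch M (E : set (euclid R n)) (U : pred (n.-tuple 'I_M.+1)) :
  set (euclid R n) := [set t | cube t /\ (t \in E) != U (code M t)].

Lemma measurable_cube_code M (U : pred (n.-tuple 'I_M.+1)) :
  measurable [set t | cube t /\ U (code M t)].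
Proof.
by rewrite cube_codeE; apply: bigsetU_measurable => i _; exact: measurable_pcell.
Qed.

Lemma measurable_mismatch M E (U : pred (n.-tuple 'I_M.+1)) :
  measurable E -> measurable (mismatch E U).
Proof.
move=> mE; rewrite (_ : mismatch E U =
    (E `&` [set t | cube t /\ predC U (code M t)]) `|`
    (~` E `&` [set t | cube t /\ U (code M t)])).
  by apply: measurableU; apply: measurableI; rewrite ?measurable_cube_code//;
    try exact: measurable_cube_code; exact: measurableC.
apply/seteqP; split=> t; rewrite /mismatch /=.
  by case: (boolP (t \in E)); rewrite ?inE ?notin_setE => tE [ct];
    case: (boolP (U _)) => //= Ut _; [left|right].
move=> [[tE [ct Ut]]|[tE [ct Ut]]]; split=> //.
  by rewrite mem_set//; case: (U _) Ut.
by rewrite memNset// Ut.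
Qed.

(** Quantifying over all [M] from [M0] on makes approximability stable under finite unions: two sets
    can then be approximated on the same grid, although no grid need refine another. *)
Definition approximable (E : set (euclid R n)) : Prop :=
  measurable E /\
  forall e : R, 0 < e -> exists M0, forall M, (M0 <= M)%N ->
    exists U : pred (n.-tuple 'I_M.+1), (leb (mismatch E U) <= e%:E)%E.

Lemma approximableC E : approximable E -> approximable (~` E).
Proof.
move=> [mE aE]; split=> [|e /aE[M0 M0P]]; first exact: measurableC.
exists M0 => M /M0P[U leU]; exists (predC U).
rewrite (_ : mismatch _ _ = mismatch E U)//.
by rewrite /mismatch; apply/seteqP; split=> t /= [ct]; rewrite in_setC => h;
  split=> //; move: h; case: (t \in E); case: (U _).
Qed.

Lemma approximable0 : approximable set0.
Proof.
split=> // e e0; exists 0%N => M _; exists pred0.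
rewrite (_ : mismatch _ _ = set0) ?measure0 ?lee_fin ?ltW//.
by apply/seteqP; split=> t // [_]; rewrite in_set0.
Qed.

Lemma approximableU E F : approximable E -> approximable F ->
  approximable (E `|` F).
Proof.
move=> [mE aE] [mF aF]; split=> [|e e0]; first exact: measurableU.
have e20 : 0 < e / 2 by rewrite divr_gt0.
have [M1 M1P] := aE _ e20; have [M2 M2P] := aF _ e20.
exists (maxn M1 M2) => M; rewrite geq_max => /andP[/M1P[U EU] /M2P[V FV]].
exists (fun i => U i || V i).
have mU := measurable_mismatch U mE; have mV := measurable_mismatch V mF.
apply: (@le_trans _ _ (leb (mismatch E U `|` mismatch F V))).
  apply: le_measureW.
  - by apply: measurable_mismatch; exact: measurableU.
  - exact: measurableU.
  - move=> t [ct]; rewrite in_setU => h.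
    have [tU|tU] := eqVneq (t \in E) (U (code M t)); last by left.
    by right; split=> //; apply: contra_neq h => ->; rewrite tU.
apply: (le_trans (measureU2 _ mU mV)).
by rewrite [e]splitr EFinD; exact: leeD.
Qed.

(** What the union has beyond its first k members decreases to the empty set. Inside the cube, which
    has finite measure, continuity from above makes it at most e/2 for some k, and the finite union
    takes the other e/2. *)
Lemma approximable_bigcup (E : (set (euclid R n))^nat) :
  (forall k, approximable (E k)) -> approximable (\bigcup_k E k).
Proof.
move=> aE; have mE k : measurable (E k) by have [] := aE k.
have mbE : measurable (\bigcup_k E k) by exact: bigcupT_measurable.
split=> // e e0.
pose F k := \big[setU/set0]_(j < k) E j.
have aF k : approximable (F k).
  rewrite /F; elim: k => [|k IH]; first by rewrite big_ord0; exact: approximable0.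
  by rewrite big_ord_recr; exact: approximableU.
pose G k := cube `&` (\bigcup_k E k `\` F k).
have mG k : measurable (G k).
  apply: measurableI; first exact: measurable_cube.
  by apply: measurableD => //; have [] := aF k.
have e20 : 0 < e / 2 by rewrite divr_gt0.
have [k Gk] : exists k, (leb (G k) <= (e / 2)%:E)%E.
  have G0 : \bigcap_k G k = set0.
    apply/seteqP; split=> // t Gt; have [_ [[k _ Ekt] _]] := Gt 0%N I.
    have [_ [_]] := Gt k.+1 I; apply.
    by rewrite /F big_ord_recr; right.
  have : (leb \o G) k @[k --> \oo] --> 0%E.
    rewrite -(measure0 leb) -G0; apply: nonincreasing_cvg_mu => //.
    - rewrite (le_lt_trans (y := leb cube))//; last by rewrite lebesgue_cube ltry.
      apply: le_measureW => //; first exact: measurable_cube.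
      by move=> t [].
    - exact: bigcapT_measurable.
    - move=> i j ij; apply/subsetPset; apply: setIS; apply: setDS.
      exact: subset_bigsetU.
  move=> G_cvg0; apply: contrapT => /forallNP noG.
  have : ((e / 2)%:E <= 0 :> \bar R)%E.
    apply: (cvge_ge (F := \oo)) G_cvg0; apply: nearW => k /=.
    by rewrite leNgt; apply/negP => /ltW /noG.
  by rewrite lee_fin leNgt e20.
have [mF /(_ _ e20)[M0 M0P]] := aF k.
exists M0 => M /M0P[U FU]; exists U.
have mU := measurable_mismatch U mF.
apply: (@le_trans _ _ (leb (mismatch (F k) U `|` G k))).
  apply: le_measureW.
  - exact: measurable_mismatch.
  - exact: measurableU.
  - move=> t [ct h].
    have [tU|tU] := eqVneq (t \in F k) (t \in \bigcup_k E k).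
      by left; split=> //; rewrite tU.
    right; split=> //; move: tU.
    have [tF|tF] := boolP (t \in F k).
      rewrite mem_set//; move: tF; rewrite inE /F -bigcup_mkord.
      by move=> [j _ Ejt]; exists j.
    have [tE _|//] := boolP (t \in \bigcup_k E k).
    by split; [rewrite inE in tE|move/mem_set; rewrite (negbTE tF)].
apply: (le_trans (measureU2 _ mU (mG k))).
by rewrite [e]splitr EFinD; exact: leeD.
Qed.

(** Select the cells whose code is coordinatewise at most that of the corner. By monotonicity of
    codes an error occurs only where some coordinate shares its slab with the corner. These are n
    slabs of measure 1/(M+1), and the threshold makes n/(M+1) at most e. *)
Lemma approximable_quadrant (x : euclid R n) : approximable (quadrant x).
Proof.
split=> [|e e0]; first exact: measurable_quadrant.
exists (Num.truncn (n%:R / e)) => M leM.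
exists (fun i : n.-tuple 'I_M.+1 => [forall k, (tnth i k <= code1 M (tnth x k : R))%N]).
pose S (k : 'I_n) : set (euclid R n) := box (fun j =>
  if j == k then slab (code1 M (tnth x k : R)) else `[0, 1]%classic).
have mS k : measurable (S k).
  apply: measurable_box => j; case: ifP => // _; exact: measurable_slab.
apply: (@le_trans _ _ (leb (\big[setU/set0]_(k < n) S k))).
  apply: le_measureW.
  - by apply: measurable_mismatch; exact: measurable_quadrant.
  - exact: bigsetU_measurable.
  - move=> t [ct].
    have [tx|tx] := boolP (t \in quadrant x).
      move: tx; rewrite inE => /quadrantP tx; case/negP.
      by rewrite eq_sym eqb_id; apply/forallP => k; rewrite tnth_mktuple; exact: code1_mono.
    case: forallP => // cx _.
    have /existsNP[k /negP] : ~ forall k, (tnth t k : R) <= tnth x k.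
      by move=> tq; move/negP: tx; apply; apply/mem_set/quadrantP.
    rewrite -ltNge => xt; rewrite -bigcup_seq; exists k; rewrite /= ?mem_index_enum// => j.
    case: eqVneq => [->|_]; last by rewrite /= in_itv; exact: ct.
    apply/slabP; split; first exact: ct.
    apply: val_inj; apply/eqP; rewrite eqn_leq (code1_mono _ (ltW xt)) andbT.
    by have := cx k; rewrite tnth_mktuple.
apply: le_trans (measure_bigsetU_le _ _ _ _) _ => //.
rewrite (eq_bigr (fun=> (M.+1%:R^-1)%:E)); last first.
  move=> k _.
  rewrite (@lebesgue_box _ _ _ (fun j => if j == k then M.+1%:R^-1 else 1)).
  - by rewrite -big_mkcond /= big_pred1_eq.
  - by move=> j; case: ifP => // _; exact: measurable_slab.
  - by move=> j; case: ifP => // _; [exact: lebesgue_slab|exact: lebesgue_itv01].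
rewrite sumEFin sumr_const card_ord lee_fin.
rewrite -[leLHS]mulr_natl ler_pdivrMr ?ltr0n// mulrC -ler_pdivrMr//.
by apply/ltW; apply: lt_le_trans (truncnS_gt _) _; rewrite ler_nat.
Qed.

Lemma approximable_measurable E : measurable E -> approximable E.
Proof.
rewrite measurable_quadrants; apply: smallest_sub.
  split=> [|A|]; first exact: approximable0.
  - by rewrite setTD; exact: approximableC.
  - exact: approximable_bigcup.
by move=> _ [x _ <-]; exact: approximable_quadrant.
Qed.

End Approximation.

(** The sum counts the integers from 1 to k that do not exceed z. Since z is at most k, it is the
    integer part of z. *)
Lemma staircase (R : realType) (k : nat) (z : R) : 0 <= z <= k%:R ->
  `|z - \sum_(j < k) (j.+1%:R <= z)%R%:R| <= 1.
Proof.
move=> /andP[z0 zk].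
have -> : \sum_(j < k) (j.+1%:R <= z)%R%:R = (minn k (Num.truncn z))%:R :> R.
  elim: k {zk} => [|k IH]; first by rewrite big_ord0 min0n.
  rewrite big_ord_recr IH /= -truncn_gt_nat -natrD; congr (_%:R).
  by rewrite /minn; case: (ltnP k _) => /=; case: ifP; lia.
have /andP[tz zt] := truncn_itv z0.
have /minn_idPr -> : (Num.truncn z <= k)%N.
  by rewrite -(ler_nat R) (le_trans tz).
by rewrite ger0_norm ?subr_ge0// lerBlDl -natr1 in zt *; apply: ltW.
Qed.

Section ApproximationFun.
Variables (R : realType) (n : nat).
Local Notation leb := (lebesgue_euclid R n).
Local Notation cube := (@cube R n).

(** By [staircase] applied to k f, the function f is within 1/k of the average of the indicators of
    its k superlevel sets. Each indicator is replaced by that of a union of cells at cost e/2; the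
    average keeps that cost, and k is chosen so that 1/k is at most e/2. *)
Lemma code_approximation (f : euclid R n -> R) :
  measurable_fun setT f -> (forall x, 0 <= f x <= 1) ->
  forall e : R, 0 < e -> exists M0, forall M, (M0 <= M)%N ->
    exists g : n.-tuple 'I_M.+1 -> R,
      (\int[leb]_(x in cube) `|f x - g (code M x)|%:E <= e%:E)%E.
Proof.
move=> mf f01 e e0.
have e20 : 0 < e / 2 by rewrite divr_gt0.
pose k := (Num.truncn (2 / e)).+1.
have k0 : 0 < k%:R :> R by rewrite ltr0n.
have ke : k%:R^-1 <= e / 2.
  rewrite -[e / 2]invrK lef_pV2 ?posrE ?invr_gt0// invf_div.
  exact/ltW/truncnS_gt.
pose E (j : 'I_k) := [set x | j.+1%:R / k%:R <= f x].
have aE j : approximable (E j).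
  apply: approximable_measurable.
  rewrite -[E j]setTI (_ : E j = f @^-1` `[j.+1%:R / k%:R, +oo[%classic).
    exact: mf.
  by apply/seteqP; split=> x; rewrite /= in_itv /= andbT.
have /(_ _)/cid-/all_sig[M0 M0P] := fun j => (aE j).2 _ e20.
(* The sum serves as a common upper bound of the k thresholds. *)
exists (\sum_j M0 j)%N => M leM.
have [|U UP] := @fin_all_exists _ _ (fun j U => (leb (mismatch (M := M) (E j) U) <= (e / 2)%:E)%E).
  by move=> j; apply: M0P; apply: leq_trans leM; rewrite (bigD1 j)//= leq_addr.
exists (fun i => k%:R^-1 * \sum_j (U j i)%:R).
have mU j : measurable (mismatch (E j) (U j)).
  by apply: measurable_mismatch; have [] := aE j.
have mC : measurable cube := @measurable_cube R n.
apply: (@le_trans _ _ (\int[leb]_(x in cube) (k%:R^-1%:E +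
    k%:R^-1%:E * \sum_(j < k) (\1_(mismatch (E j) (U j)) x)%:E))%E).
  apply: ge0_le_integralW => x cx; first by rewrite lee_fin.
  rewrite sumEFin -EFinM -EFinD lee_fin.
  rewrite (_ : f x - _ = k%:R^-1 * ((k%:R * f x - \sum_(j < k) (j.+1%:R <= k%:R * f x)%R%:R)
     + \sum_(j < k) ((j.+1%:R <= k%:R * f x)%R%:R - (U j (code M x))%:R))); last first.
    rewrite sumrB; set a := \sum_(j < k) (_ <= _)%R%:R; set b := \sum_j _.
    by rewrite addrA subrK mulrBr mulKf// gt_eqF.
  rewrite normrM [`|k%:R^-1|]ger0_norm ?invr_ge0 ?(ltW k0)//.
  rewrite -[X in _ <= X + _]mulr1 -mulrDr ler_pM2l ?invr_gt0//.
  apply: le_trans (ler_normD _ _) _; apply: lerD.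
    apply: staircase; have /andP[fx0 fx1] := f01 x.
    by rewrite mulr_ge0 ?(ltW k0)//= -[leRHS]mulr1 ler_pM2l.
  apply: le_trans (ler_norm_sum _ _ _) _; apply: ler_sum => j _.
  rewrite indicE; have -> : (j.+1%:R <= k%:R * f x)%R = (x \in E j).
    by rewrite [k%:R * _]mulrC -ler_pdivrMr//; apply/idP/idP => [?|/set_mem//]; rewrite inE.
  have [eUE|neUE] := eqVneq (x \in E j) (U j (code M x)).
    by rewrite eUE subrr normr0 ler0n.
  rewrite mem_set//; move: neUE; case: (x \in E j); case: (U _ _) => //= _.
    by rewrite subr0 normr1.
  by rewrite sub0r normrN normr1.
rewrite ge0_integralD//; last 2 first.
- by move=> x _; apply: mule_ge0; [rewrite lee_fin invr_ge0 ltW|apply: sume_ge0].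
- by apply: measurable_funeM; apply: emeasurable_sum => j; apply/measurable_EFinP; exact: measurable_indic.
rewrite integral_cst// [leb _]lebesgue_cube mule1 ge0_integralZl//; last 2 first.
- by apply: emeasurable_sum => j; apply/measurable_EFinP; exact: measurable_indic.
- by move=> x _; apply: sume_ge0.
rewrite ge0_integral_sum//; last first.
  by move=> j; apply/measurable_EFinP; exact: measurable_indic.
rewrite [e]splitr EFinD; apply: leeD; first by rewrite lee_fin.
apply: (@le_trans _ _ (k%:R^-1%:E * \sum_(j < k) (e / 2)%:E)%E).
  apply: lee_wpmul2l; first by rewrite lee_fin invr_ge0 ltW.
  apply: lee_sum => j _; rewrite integral_indic//.
  apply: le_trans (UP j); apply: le_measureW => //.
  exact: measurableI.
rewrite sumEFin sumr_const card_ord -EFinM lee_fin.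
by rewrite -[(e / 2) *+ k]mulr_natl mulKf// gt_eqF.
Qed.

End ApproximationFun.

(** * Disintegration *)

Definition push_measure d1 d2 (T1 : measurableType d1) (T2 : measurableType d2)
    (R : realType) (m : {measure set T1 -> \bar R}) (f : T1 -> T2)
    (mf : measurable_fun setT f) : {measure set T2 -> \bar R} :=
  measure_function_pushforward__canonical__measure_function_Measure m mf.

(** * Almost everywhere comparison and densities of dominated measures *)

Section Comparison.
Context d (X : measurableType d) (R : realType).
Implicit Types m nu : {measure set X -> \bar R}.

(** The maximum of f and g has the same integrals as g: where f <= g it is g, and elsewhere it is f,
    whose integral the hypothesis bounds by that of g. As g is integrable, g equals the maximum
    almost everywhere. *)
Lemma ae_le_integral m (f g : X -> \bar R) :
  measurable_fun setT f -> measurable_fun setT g ->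
  (forall x, 0 <= f x)%E -> (forall x, 0 <= g x)%E ->
  (\int[m]_x g x < +oo)%E ->
  (forall E, measurable E -> \int[m]_(x in E) f x <= \int[m]_(x in E) g x)%E ->
  {ae m, forall x, f x <= g x}%E.
Proof.
move=> mf mg f0 g0 goo fg.
have mh : measurable_fun setT (fun x => maxe (f x) (g x)).
  exact: measurable_maxe.
have gi : m.-integrable setT g.
  apply/integrableP; split=> //; rewrite (eq_integral g)// => x _.
  by rewrite gee0_abs.
have : ae_eq m setT g (fun x => maxe (f x) (g x)).
  apply: integral_ae_eq => // E _ mE; apply/eqP; rewrite eq_le; apply/andP; split.
    by apply: ge0_le_integralW => x _ //; rewrite le_max lexx orbT.
  pose A := [set x | (f x <= g x)%E].
  have mA : measurable A.
    rewrite -[A]setTI; exact: measurable_lee.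
  have mEA : measurable (E `&` A) by exact: measurableI.
  have mED : measurable (E `\` A) by exact: measurableD.
  have dEA : [disjoint E `&` A & E `\` A].
    by apply/disj_setPS => x [[_ Ax] [_ nAx]].
  rewrite -(setUIDK E A) !ge0_integral_setU//; last 3 first.
  - exact: measurable_funTS.
  - exact: measurable_funTS.
  - by move=> x _; rewrite le_max f0.
  apply: leeD.
    by apply: ge0_le_integralW => x [_ Ax]; rewrite ?le_max ?f0// ge_max lexx andbT.
  apply: le_trans (fg _ mED); apply: ge0_le_integralW => x [_ /negP].
    by rewrite le_max f0.
  by rewrite -ltNge => /ltW gf; rewrite ge_max lexx gf.
by move=> [N [mN N0 NP]]; exists N; split=> // x fgx; apply: NP => /= h;
  apply: fgx; rewrite /= (h I) le_max lexx.
Qed.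

Lemma density_of_le m nu : (m setT < +oo)%E ->
  (forall E, measurable E -> nu E <= m E)%E ->
  exists f : X -> \bar R, [/\ forall x, (0 <= f x)%E, measurable_fun setT f &
    forall E, measurable E -> nu E = (\int[m]_(x in E) f x)%E].
Proof.
move=> moo num.
have nuoo : (nu setT < +oo)%E by apply: le_lt_trans moo; exact: num.
(* Restriction to the whole space changes neither measure; it only provides the finite-measure
   structure. Absolute continuity is immediate from the domination. *)
have [|f [f0 fi fE]] := @radon_nikodym_finite _ X R
  (mfrestr measurableT moo) (mfrestr measurableT nuoo).
  move=> N mN A mA AN; have : m (A `&` setT) = 0%E := mN A mA AN.
  rewrite setIT => mA0; suff : nu (A `&` setT) = 0%E by []; rewrite setIT; apply/eqP.
  by rewrite eq_le measure_ge0 andbT -mA0 num.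
exists f; split=> //; first by move/integrableP : fi => [].
move=> E mE; rewrite -[E in nu E]setIT; apply: etrans (fE E mE) _.
by apply: eq_measure_integral => A mA _; rewrite -[A in RHS]setIT.
Qed.

End Comparison.

(** * Kernels obtained by transporting the uniform law *)

Section QuantileKernel.
Context d (X : measurableType d) (R : realType).
Variable Q : X * measurableTypeR R -> measurableTypeR R.
Local Notation lam := (mrestr (@lebesgue_measure R) (measurable_itv `[0%R, 1%R])).

Lemma measurable_slice (mQ : measurable_fun setT Q) x :
  measurable_fun setT (fun u => Q (x, u)).
Proof. exact: measurableT_comp mQ (pair1_measurable x). Qed.

Definition quantile_kernel (mQ : measurable_fun setT Q) (x : X) :
    {measure set (measurableTypeR R) -> \bar R} :=
  push_measure lam (measurable_slice mQ x).

Hypothesis mQ : measurable_fun setT Q.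

(** The value at x is the length of the x-section of a fixed measurable set, so measurability in x
    is the one known from product measures. *)
Lemma measurable_quantile_kernel U : measurable U ->
  measurable_fun setT (quantile_kernel mQ ^~ U).
Proof.
move=> mU; have mQU : measurable (Q @^-1` U) by rewrite -[_ @^-1` _]setTI; exact: mQ.
rewrite (_ : quantile_kernel mQ ^~ U = fun x =>
    @lebesgue_measure R (xsection ((Q @^-1` U) `&` (setT `*` `[0, 1]%classic)) x)).
  by apply: measurable_fun_xsection; apply: measurableI => //; exact: measurableX.
apply/funext => x; congr (lebesgue_measure _).
apply/seteqP; split=> u; rewrite /xsection /= inE.
  by move=> [QU u01]; split.
by move=> [QU [_ u01]]; split.
Qed.

HB.instance Definition _ := isKernel.Build _ _ _ _ _ (quantile_kernel mQ)
  measurable_quantile_kernel.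

Lemma quantile_kernelT x : quantile_kernel mQ x setT = 1%E.
Proof. by rewrite /= /pushforward preimage_setT /mrestr setTI; exact: lebesgue_itv01. Qed.

HB.instance Definition _ := Kernel_isProbability.Build _ _ _ _ _
  (quantile_kernel mQ) quantile_kernelT.

End QuantileKernel.

Section Disintegration.
Context d (X : measurableType d) (R : realType).
Local Notation RR := (measurableTypeR R).

(** Rays are taken open because the quantile is an infimum: that it lies below r is a countable
    condition on the rational levels below r ([quantile_lt]). *)
Definition ray_rectangles : set (set (X * RR)) :=
  [set A | exists E r, measurable E /\ A = E `*` `]-oo, r[%classic].

Lemma measurable_ray_rectangles :
  @measurable _ (X * RR)%type = <<s ray_rectangles >>.
Proof.
apply/seteqP; split; last first.
  apply: smallest_sub; first exact: sigma_algebra_measurable.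
  by move=> _ [E [r [mE ->]]]; exact: measurableX.
suff mid : measurable_fun setT
    (idfun : g_sigma_algebraType ray_rectangles -> (X * RR)%type).
  by move=> A mA; have := mid measurableT A mA; rewrite setTI.
apply/measurable_fun_pairP; split.
  move=> _ E mE; rewrite setTI.
  rewrite (_ : _ @^-1` _ = \bigcup_k (E `*` `]-oo, (k%:R : R)[%classic)).
    apply: bigcupT_measurable => k; apply: sub_sigma_algebra.
    by exists E, k%:R.
  apply/seteqP; split=> -[x u] /=; last by move=> [k _ []].
  move=> Ex; exists (Num.truncn `|u|).+1 => //; split=> //=.
  by rewrite in_itv /= (le_lt_trans (ler_norm _))// truncnS_gt.
apply: (measurability _ (RGenInftyO.measurableE R)) => //.
move=> _ [_ [r ->] <-]; rewrite setTI.
apply: sub_sigma_algebra; exists setT, r; split=> //.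
by apply/seteqP; split=> -[x u] //= [].
Qed.

Lemma ray_measure_unique (P1 P2 : {measure set (X * RR) -> \bar R}) :
  (P1 setT < +oo)%E ->
  (forall E r, measurable E ->
    P1 (E `*` `]-oo, r[%classic) = P2 (E `*` `]-oo, r[%classic)) ->
  forall A, measurable A -> P1 A = P2 A.
Proof.
move=> Poo P12 A mA.
apply: (measure_unique ray_rectangles
    (fun k => setT `*` `]-oo, (k%:R : R)[%classic)) => //.
- exact: measurable_ray_rectangles.
- move=> _ _ [E [r [mE ->]]] [F [s [mF ->]]].
  exists (E `&` F), (Order.min r s); split; first exact: measurableI.
  apply/seteqP; split=> -[x u] /=; rewrite !in_itv /= lt_min.
    by move=> [[? ?] [? ?]]; split=> //; apply/andP.
  by move=> [[? ?] /andP[? ?]].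
- by move=> k; exists setT, k%:R.
- apply/seteqP; split=> // -[x u] _; exists (Num.truncn `|u|).+1 => //; split=> //=.
  by rewrite in_itv /= (le_lt_trans (ler_norm _))// truncnS_gt.
- by move=> _ [E [r [mE ->]]]; exact: P12.
- move=> k; apply: le_lt_trans Poo; apply: le_measureW => //.
  exact: measurableX.
Qed.

Section Quantile.
Variable D : R -> X -> \bar R.
Hypothesis mD : forall r, measurable_fun setT (D r).

(* With D r a version of the conditional distribution function at r, the infimum
   of these levels is its generalized inverse at u. It lies in [0, 1] for every x,
   so no null set has to be discarded to make quantile_kernel a kernel. *)
Definition quantile_levels (p : X * RR) : set R :=
  [set y | y = 1 \/ exists q : rat,
     [/\ y = ratr q, 0 <= (ratr q : R) <= 1 & (p.2%:E <= D (ratr q) p.1)%E]].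

Definition quantile (p : X * RR) : RR := inf (quantile_levels p).

Lemma quantile_levels01 p (y : R) : quantile_levels p y -> 0 <= y <= 1.
Proof. by case=> [->|[q [-> ? _]]//]; rewrite ler01 lexx. Qed.

Lemma quantile_lb p : lbound (quantile_levels p) 0.
Proof. by move=> y /quantile_levels01/andP[]. Qed.

Lemma quantile_has_inf p : has_inf (quantile_levels p).
Proof. by split; [exists 1; left|exists 0; exact: quantile_lb]. Qed.

Lemma quantile01 p : (0 <= (quantile p : R)) && ((quantile p : R) <= 1).
Proof.
apply/andP; split.
  by apply: lb_le_inf (@quantile_lb p); exists 1; left.
by apply: ge_inf; [case: (quantile_has_inf p)|left].
Qed.

(** An infimum is below r exactly when some member is. The level 1, added to keep the set nonempty,
    is not such a member since r <= 1. *)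
Lemma quantile_lt p (r : R) : r <= 1 -> (quantile p : R) < r <->
  exists q : rat, 0 <= (ratr q : R) < r /\ (p.2%:E <= D (ratr q) p.1)%E.
Proof.
move=> r1; split=> [/inf_lt-/(_ (quantile_has_inf p).1)[y []]|[q [/andP[q0 qr] uD]]].
- by move=> ->; rewrite ltNge r1.
- by move=> [q [-> /andP[q0 _] uD] qr]; exists q; rewrite q0 qr.
- apply: le_lt_trans (qr); apply: ge_inf; first by case: (quantile_has_inf p).
  by right; exists q; split=> //; rewrite q0 (le_trans (ltW qr)).
Qed.

Lemma measurable_quantile : measurable_fun setT quantile.
Proof.
apply: (measurability _ (RGenInftyO.measurableE R)) => //.
move=> _ [_ [r ->] <-]; rewrite setTI.
have [r1|r1] := leP r 1; last first.
  rewrite (_ : _ @^-1` _ = setT)//; apply/seteqP; split=> // p _ /=.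
  by rewrite in_itv /=; have /andP[_ /le_lt_trans->] := quantile01 p.
rewrite (_ : _ @^-1` _ = \bigcup_(q : rat) (if 0 <= (ratr q : R) < r then
    [set p : X * RR | (p.2%:E <= D (ratr q) p.1)%E] else set0)).
  apply: bigcupT_measurable_rat => q; case: ifP => // _.
  rewrite -[X in measurable X]setTI; apply: measurable_lee => //.
    by apply/measurable_EFinP; exact: measurable_snd.
  exact: measurableT_comp (mD _) measurable_fst.
apply/seteqP; split=> p /=; rewrite in_itv /=.
  by move/(quantile_lt p r1) => [q [qr uD]]; exists q => //; rewrite qr.
move=> [q _]; case: ifP => // qr uD; apply/(quantile_lt p r1).
by exists q.
Qed.

End Quantile.

End Disintegration.

Section Disintegration.
Context d (X : measurableType d) (R : realType).
Local Notation RR := (measurableTypeR R).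
Variables (m : {measure set X -> \bar R}) (P : {measure set (X * RR) -> \bar R}).
Hypothesis moo : (m setT < +oo)%E.
Hypothesis Pm : forall E, measurable E -> P (E `*` setT) = m E.
Hypothesis P01 : P (setT `*` ~` `[0, 1]%classic) = 0%E.

(** For fixed F the mass of E x F is dominated by the first marginal [m] of [P], so [density_of_le]
    applies. *)
Lemma rectangle_density (F : set RR) : measurable F ->
  exists f : X -> \bar R, [/\ forall x, (0 <= f x)%E, measurable_fun setT f &
    forall E, measurable E -> P (E `*` F) = (\int[m]_(x in E) f x)%E].
Proof.
move=> mF; have mTF : measurable ((setT : set X) `*` F) by exact: measurableX.
pose nu := push_measure (mrestr P mTF) (@measurable_fst _ _ X RR).
have nuE E : nu E = P (E `*` F).
  rewrite /nu /= /pushforward /mrestr; congr (P _).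
  by apply/seteqP; split=> -[x u] [Ex]; [move=> [_ Fu]|move=> Fu].
have [E mE|f [f0 mf fE]] := @density_of_le _ _ _ m nu moo.
  rewrite nuE -Pm//; apply: le_measureW; first exact: measurableX.
    exact: measurableX.
  by move=> -[x u] [].
by exists f; split=> // E mE; rewrite -nuE fE.
Qed.

Local Notation I01 := (`[0, 1]%classic : set RR).
Local Notation lam01 := (fun A => @lebesgue_measure R (A `&` `[0, 1]%classic)).

Lemma lam01_ray (c : \bar R) : (0 <= c <= 1)%E ->
  lam01 [set u : R | (u%:E <= c)%E] = c.
Proof.
case: c => [c| |] //; last by rewrite leye_eq andbF.
rewrite !lee_fin => /andP[c0 c1].
rewrite (_ : _ `&` _ = `[0, c]%classic).
  rewrite lebesgue_measure_itv /= lte_fin oppr0 adde0; case: ltgtP c0 => // <-//.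
apply/seteqP; split=> u /=; rewrite !in_itv /= lee_fin.
  by move=> [-> /andP[->]].
by move=> /andP[-> uc]; rewrite uc (le_trans uc).
Qed.

(** For 0 < r <= 1, K x ]-oo, r[ is the probability that a uniform u satisfies u <= D q x for some
    rational q in [0, r[. It is at most the density G of ]-oo, r[, because almost everywhere D q <=
    G for all these q at once. It is at least each D q almost everywhere, and letting q increase to
    r recovers P (E x ]-oo, r[). No regularity of r |-> D r x is established on the way. *)
Lemma disintegration : exists K : R.-pker X ~> RR,
  (forall x, K x `[0, 1]%classic = 1%E) /\
  forall E F, measurable E -> measurable F ->
    P (E `*` F) = (\int[m]_(x in E) K x F)%E.
Proof.
have m1 E : measurable E -> (\int[m]_(x in E) 1 = m E)%E.
  by move=> mE; rewrite integral_cst// mul1e.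
have /choice[D DP] : forall r : R, exists f : X -> \bar R,
    [/\ forall x, (0 <= f x)%E, measurable_fun setT f &
    forall E, measurable E -> P (E `*` `]-oo, r]) = (\int[m]_(x in E) f x)%E].
  by move=> r; exact: rectangle_density.
have mD r : measurable_fun setT (D r) by have [] := DP r.
have D0 r x : (0 <= D r x)%E by have [] := DP r.
have DE r E : measurable E -> P (E `*` `]-oo, r]) = (\int[m]_(x in E) D r x)%E.
  by have [_ _] := DP r; exact.
pose Q := quantile D; pose mQ : measurable_fun setT Q := measurable_quantile mD.
pose K : R.-pker X ~> RR := quantile_kernel mQ.
have KE x F : K x F = lam01 [set u | F (Q (x, u))] by [].
have mK F : measurable F -> measurable_fun setT (fun x => K x F).
  exact: measurable_kernel.
have mlt r (x : X) : measurable [set u : RR | (Q (x, u) : R) < r].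
  have := measurable_slice mQ x measurableT (measurable_itv `]-oo, r[).
  by rewrite setTI; congr measurable; apply/seteqP; split=> u; rewrite /= in_itv.
have mle c : measurable [set u : RR | ((u : R)%:E <= c)%E].
  rewrite -[X in measurable X]setTI; apply: (@measurable_lee _ RR R setT _ EFin (cst c)) => //.
have KrE x r : K x `]-oo, r[%classic = lam01 [set u | (Q (x, u) : R) < r].
  by rewrite KE; congr lebesgue_measure; apply/seteqP; split=> u; rewrite /= in_itv.
have PE0 E F : measurable E -> measurable F -> F `<=` ~` I01 -> P (E `*` F) = 0%E.
  move=> mE mF F01; apply: (@subset_measure0 _ _ _ P _ (setT `*` ~` I01)) => //.
  - exact: measurableX.
  - by apply: measurableX => //; exact: measurableC.
  - by move=> -[x u] [_ /F01].
have K1 x F : measurable F -> (K x F <= 1)%E.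
  move=> mF; rewrite KE -lebesgue_itv01; apply: le_measureW => //.
  apply: measurableI => //; have := measurable_slice mQ x measurableT mF.
  by rewrite setTI.
have main E r : measurable E ->
    P (E `*` `]-oo, r[) = (\int[m]_(x in E) K x `]-oo, r[%classic)%E.
  move=> mE; have [r0|r0] := leP r 0.
    rewrite PE0//; last first.
      move=> u /=; rewrite !in_itv /= => ur /andP[u0 _].
      by move: (lt_le_trans ur r0); rewrite ltNge u0.
    rewrite integral0_eq// => x _; rewrite KrE (_ : [set u | _] = set0) ?set0I ?measure0//.
    apply/seteqP; split=> // u /= Qr.
    have /andP[Q0 _] := quantile01 D (x, u).
    by move: (lt_le_trans Qr r0); rewrite ltNge Q0.
  have [r1|r1] := ltP 1 r.
    rewrite (eq_integral (fun=> 1%E)); last first.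
      move=> x _; rewrite KrE (_ : [set u | _] = setT) ?setTI ?lebesgue_itv01//.
      apply/seteqP; split=> // u _ /=.
      have /andP[_ Q1] := quantile01 D (x, u).
      exact: le_lt_trans r1.
    rewrite m1// -Pm// (_ : E `*` setT = E `*` `]-oo, r[%classic `|` E `*` ~` `]-oo, r[%classic); last first.
      apply/seteqP; split=> -[x u]; last by move=> [] [].
      by move=> [Ex _]; have [ur|ur] := pselect (`]-oo, r[%classic u); [left|right].
    rewrite measureU; last 3 first.
    - exact: measurableX.
    - by apply: measurableX => //; exact: measurableC.
    - by apply/seteqP; split=> // -[x u] [[_ ur] [_ /(_ ur)]].
    rewrite [X in _ = (_ + X)%E]PE0 ?adde0//; first exact: measurableC.
    move=> u /=; rewrite !in_itv /= => ur /andP[_ u1]; apply: ur.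
    exact: le_lt_trans r1.
  have [G [G0 mG GE]] := rectangle_density (measurable_itv `]-oo, r[ : measurable (_ : set RR)).
  have mrayS E' r1' r2' : measurable E' -> r1' < r2' :> R ->
      (P (E' `*` `]-oo, r1']) <= P (E' `*` `]-oo, r2'[))%E.
    move=> mE' r12; apply: le_measureW; [exact: measurableX..|].
    move=> -[x u] [E'x]; rewrite /= !in_itv /= => ur; split=> //=.
    by rewrite ?in_itv /= (le_lt_trans ur).
  have finI f : (\int[m]_x f x <= m setT -> \int[m]_x f x < +oo)%E.
    by move=> /le_lt_trans; apply.
  have Ptot E' F : measurable E' -> measurable F -> (P (E' `*` F) <= m E')%E.
    move=> mE' mF; rewrite -Pm//; apply: le_measureW; [exact: measurableX..|].
    by move=> -[x u] [].
  apply/eqP; rewrite eq_le; apply/andP; split; last first.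
    rewrite GE//; apply: ae_ge0_le_integral => //.
    - by apply: measurable_funTS; exact: mK.
    - exact: measurable_funTS.
    (* The rationals are enumerated through [unpickle], so that countably many almost sure
       statements can be joined by [ae_foralln]; numbers that code no rational get a trivial one. *)
    have aeDG (k : nat) : {ae m, forall x, if unpickle k is Some q then
        (ratr q < r)%R -> (D (ratr q) x <= G x)%E else True}.
      case: (unpickle k : option rat) => [q|]; last exact: aeW.
      have [qr|qr] := ltP (ratr q) r; last exact: aeW.
      apply: filterS (ae_le_integral (mD (ratr q)) mG (D0 _) G0 _ _) => //.
        by apply: finI; rewrite -GE//; exact: Ptot.
      by move=> E' mE'; rewrite -GE// -DE//; exact: mrayS.
    have /ae_foralln aeDG' := aeDG.
    apply: filterS aeDG' => x DG Ex.
    (* [lam01_ray] requires a value in [0, 1]; where G x exceeds 1, the total mass of the kernel is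
       bound enough. *)
    have [G1|G1] := leP (G x) 1%E; last first.
      by apply: le_trans (ltW G1); exact: K1.
    rewrite KrE -[leRHS]lam01_ray ?G0//; apply: le_measureW.
    - exact: measurableI.
    - by apply: measurableI => //; exact: mle.
    - apply: setSI => u /= /(quantile_lt D _ r1)[q [/andP[q0 qr] uD]].
      apply: le_trans uD _; have := DG (pickle q); rewrite pickleK; exact.
  have Dle (q : rat) : 0 <= (ratr q : R) < r ->
      (P (E `*` `]-oo, (ratr q : R)]) <= \int[m]_(x in E) K x `]-oo, r[%classic)%E.
    move=> qr; rewrite DE//; apply: ae_ge0_le_integral => //.
    - exact: measurable_funTS.
    - by apply: measurable_funTS; exact: mK.
    have aeD1 : {ae m, forall x, D (ratr q) x <= 1}%E.
      apply: ae_le_integral => //; first by apply: finI; rewrite m1.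
      by move=> E' mE'; rewrite -DE// m1// Ptot.
    apply: filterS aeD1 => x D1 Ex.
    rewrite KrE -[leLHS]lam01_ray ?D0//; apply: le_measureW.
    - by apply: measurableI => //; exact: mle.
    - exact: measurableI.
    - by apply: setSI => u /= uD; apply/(quantile_lt D _ r1); exists q.
  (* The closed rays ending at r - 1/(k+1) increase to the open ray ending at r, so continuity from
     below reduces the claim to rational endpoints q < r. *)
  pose F k := E `*` `]-oo, (r - k.+1%:R^-1)%R]%classic : set (X * RR).
  have mF k : measurable (F k) by exact: measurableX.
  have FE : \bigcup_k F k = E `*` `]-oo, r[%classic.
    apply/seteqP; split=> -[x u] /=.
      move=> [k _ [Ex]]; rewrite /= !in_itv /= => ur; split=> //.
      by rewrite ?in_itv /=; apply: le_lt_trans ur _; rewrite ltrBlDr ltrDl.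
    rewrite ?in_itv /= => -[Ex ur]; exists (Num.truncn (r - u)^-1) => //.
    split=> //=; rewrite ?in_itv /= lerBrDr -lerBrDl -[leRHS]invrK lef_pV2 ?posrE ?ltr0n ?invr_gt0 ?subr_gt0//.
    exact/ltW/truncnS_gt.
  have Fcvg : (P \o F) k @[k --> \oo] --> P (E `*` `]-oo, r[%classic).
    rewrite -FE; apply: nondecreasing_cvg_mu => //.
      by apply: bigcupT_measurable.
    move=> i j ij; apply/subsetPset => -[x u] [Ex]; rewrite /= !in_itv /= => ur.
    split=> //=; rewrite ?in_itv /= (le_trans ur)// lerD2l lerN2.
    by rewrite lef_pV2 ?posrE ?ltr0n// ler_nat.
  apply: (cvge_le (F := \oo)) Fcvg; apply: nearW => k /=.
  (* The maximum with 0 keeps q in [0, 1], where [quantile_levels] looks for rationals. *)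
  have [q] : exists q : rat, ratr q \in `](Order.max 0 (r - k.+1%:R^-1)), r[.
    by apply: rat_in_itvoo; rewrite gt_max r0 ltrBlDr ltrDl invr_gt0 ltr0n.
  rewrite ?in_itv /= gt_max => /andP[/andP[q0 kq] qr].
  apply: le_trans (Dle q _); last by rewrite ltW.
  apply: le_measureW => //; first exact: measurableX.
  move=> -[x u] [Ex]; rewrite /= !in_itv /= => ur; split=> //=.
  by rewrite ?in_itv /= (le_trans ur)// ltW.
exists K; split=> [x|E F mE mF].
  rewrite KE (_ : [set u | _] = setT) ?setTI ?lebesgue_itv01//.
  by apply/seteqP; split=> // u _; rewrite /= in_itv; exact: quantile01.
have mphi : measurable_fun setT (fun p : X * RR => (p.1, Q p)).
  exact: measurable_fun_pair.
have mX01 : measurable ((setT : set X) `*` I01) by exact: measurableX.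
(* The law of (x, Q (x, u)) with u uniform and independent of x. It turns the integral of the kernel
   into the value of a measure on the product, so that the identity on rays extends to all
   measurable F. *)
pose mu2 := push_measure (mrestr (m \x @lebesgue_measure R)%E mX01) mphi.
have mu2E E' F' : measurable E' -> measurable F' ->
    mu2 (E' `*` F') = (\int[m]_(x in E') K x F')%E.
  move=> mE' mF'; rewrite integral_mkcond; apply: eq_integral => x _.
  rewrite /patch; case: ifPn => xE /=.
    rewrite KE; congr lebesgue_measure; apply/seteqP; split=> u; rewrite /xsection /= inE.
      by move=> [[]] _ QF [_ u01].
    by move=> [QF u01]; split=> //; split=> //=; rewrite inE in xE.
  rewrite (_ : xsection _ _ = set0) ?measure0//; apply/seteqP; split=> // u.
  by rewrite /xsection /= inE => -[[Ex]] ; move: xE; rewrite notin_setE.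
rewrite -mu2E//; apply: ray_measure_unique; last exact: measurableX.
  by rewrite -setXTT Pm.
by move=> E' r mE'; rewrite mu2E// main.
Qed.

End Disintegration.

(** * Copula measures and the checkerboard measure *)

(** Makes a density that is constant on each of finitely many sets into a bundled measure, built
    from rescaled restrictions of [m]. *)
Lemma weighted_measure d (T : measurableType d) (R : realType)
    (m : {measure set T -> \bar R}) (I : finType) (w : I -> R) (A : I -> set T) :
  (forall i, 0 <= w i) -> (forall i, measurable (A i)) ->
  exists Q : {measure set T -> \bar R},
    forall S, Q S = (\sum_i (w i)%:E * m (S `&` A i))%E.
Proof.
move=> w0 mA.
have [/card0_eq I0|/card_gt0P[i0 _]] := posnP #|I|.
  by exists mzero => S; rewrite big1// => i; have := I0 i; rewrite inE.
pose e k := nth i0 (enum I) k.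
pose F k : {measure set T -> \bar R} :=
  mscale (NngNum (w0 (e k))) (mrestr m (mA (e k))).
exists (msum F (size (enum I))) => S.
by rewrite /msum /= -big_enum (big_nth i0) big_mkord.
Qed.

Lemma measure_probability d (T : measurableType d) (R : realType)
    (m : {measure set T -> \bar R}) : m setT = 1%E ->
  exists P : probability T R, forall S, P S = m S.
Proof.
move=> m1; exists (mnormalize m (dirac point)) => S.
by rewrite /= /mnormalize m1 /= onee_eq0 /= invr1 mule1.
Qed.

Lemma distribution_setC (R : realType) n (C : euclid R n -> R)
    (P : probability (euclid R n) R) :
  has_distribution_function P C -> P (~` @cube R n) = 0%E.
Proof.
move=> dP; rewrite probability_setC; last exact: measurable_cube.
by have [-> _] := dP; rewrite subee.
Qed.

Section Margins.
Variables (R : realType) (n : nat) (C : euclid R n -> R).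
Variable P : probability (euclid R n) R.
Hypothesis dP : has_distribution_function P C.

Lemma distribution_setI A : measurable A -> P (A `&` @cube R n) = P A.
Proof.
move=> mA; apply: measure_setI_full => //; first exact: measurable_cube.
exact: distribution_setC dP.
Qed.

Lemma distribution_unique (Q : probability (euclid R n) R) :
  has_distribution_function Q C -> forall A, measurable A -> P A = Q A.
Proof.
move=> dQ; apply: lower_box_measure_unique.
- exact: distribution_setC dP.
- exact: distribution_setC dQ.
- suff : (P (@cube R n) < +oo)%E by []; have [-> _] := dP; exact: ltry.
- by move=> x cx; apply: etrans (dP.2 _ cx) _; exact/esym/dQ.2.
Qed.

Hypothesis cC : is_copula C.

(** The i-th coordinate is read as a map into one-dimensional Euclidean space, where
    [lower_box_measure_unique] applies. On a lower box the claim is the margin condition, C being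
    evaluated where all other coordinates are 1. *)
Lemma copula_margin (i : 'I_n) F : measurable F ->
  P [set t | F (tnth t i)] = @lebesgue_measure R (F `&` `[0, 1]%classic).
Proof.
move=> mF.
pose f (t : euclid R n) : euclid R 1 := [tuple tnth t i | _ < 1].
have mf : measurable_fun setT f.
  apply/measurable_fun_tnthP => k; rewrite (_ : _ \o _ = (@tnth n _)^~ i).
    exact: measurable_tnth.
  by apply/funext => t /=; rewrite tnth_mktuple.
have e1 G : measurable G ->
    lebesgue_euclid R 1 (box (fun=> G)) = @lebesgue_measure R G.
  move=> mG; rewrite boxS lebesgue_tprod//; last exact: measurable_box.
  rewrite (@lebesgue_box _ _ _ (fun=> 1))//; last by move=> [].
  by rewrite big_ord0 mul1e.
pose m2 : {measure set (euclid R 1) -> \bar R} :=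
  mrestr (lebesgue_euclid R 1) (@measurable_cube R 1).
have -> : [set t | F (tnth t i)] = f @^-1` (box (fun=> F)).
  apply/seteqP; split=> t /=; first by move=> Ft k; rewrite tnth_mktuple.
  by move=> /(_ ord0); rewrite tnth_mktuple.
have -> : @lebesgue_measure R (F `&` `[0, 1]%classic) = m2 (box (fun=> F)).
  rewrite /m2 /= /mrestr cubeE -e1//; last exact: measurableI.
  congr (lebesgue_euclid R 1 _).
  by apply/seteqP; split=> t; [move=> h; split=> k; have [] := h k|move=> [h1 h2] k; split].
have cf : f @^-1` (@cube R 1) `&` @cube R n = @cube R n.
  apply/seteqP; split=> t; first by move=> [].
  by move=> ct; split=> // k; rewrite tnth_mktuple.
apply: (@lower_box_measure_unique R 1 (push_measure P mf) m2); last exact: measurable_box.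
- apply: (@subset_measure0 _ _ _ P _ (~` @cube R n)).
  + rewrite -[X in measurable X]setTI; apply: mf => //; apply: measurableC.
    exact: measurable_cube.
  + by apply: measurableC; exact: measurable_cube.
  + by move=> t /= nt ct; apply: nt; have := ct; rewrite -{1}cf => -[].
  + exact: distribution_setC dP.
- by rewrite /m2 /= /mrestr setICl measure0.
- rewrite (le_lt_trans (probability_le1 _ _)) ?ltry//.
  rewrite -[X in measurable X]setTI; apply: mf => //; exact: measurable_cube.
- move=> x cx.
  rewrite /m2 /= /mrestr /pushforward setIidl; last first.
    move=> t lt k; have /andP[t0 tx] := lt k; rewrite t0 (le_trans tx)//.
    by have /andP[] := cx k.
  rewrite [RHS](lebesgue_lower_box cx) big_ord1.
  have mfx : measurable (f @^-1` lower_box x).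
    rewrite -[X in measurable X]setTI; apply: mf => //; exact: measurable_lower_box.
  rewrite -distribution_setI//.
  have x01 : 0 <= (tnth x ord0 : R) <= 1 := cx ord0.
  apply: etrans (congr1 EFin (cC.2 i _ x01)).
  apply: etrans (dP.2 _ _); last first.
    move=> j; rewrite tnth_mktuple; case: ifP => _; first exact: cx.
    by rewrite ler01 lexx.
  congr (P _); apply/seteqP; split=> t.
    move=> [ft ct] j; rewrite tnth_mktuple; case: eqVneq => [->|_]; last exact: ct.
    by have := ft ord0; rewrite tnth_mktuple.
  move=> lt; split=> j.
    rewrite tnth_mktuple; have := lt i; rewrite tnth_mktuple eqxx.
    by rewrite (ord1 j).
  have := lt j; rewrite tnth_mktuple; case: eqVneq => // _ /andP[-> tx].
  by rewrite (le_trans tx)//; have /andP[] := cx ord0.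
Qed.

Lemma copula_hyperplane (i : 'I_n) (a : R) :
  P (@cube R n `&` [set t | (tnth t i : R) = a]) = 0%E.
Proof.
have mH : measurable [set t : euclid R n | [set a] (tnth t i)].
  by have := measurable_tnth i measurableT (measurable_set1 (a : measurableTypeR R)); rewrite setTI.
rewrite setIC distribution_setI//.
apply: etrans (copula_margin i (measurable_set1 (a : measurableTypeR R))) _.
apply: (@subset_measure0 _ _ _ (@lebesgue_measure R) _ [set a]) => //.
- exact: measurableI.
- exact: lebesgue_measure_set1.
Qed.

End Margins.

Section Cells.
Variables (R : realType) (n : nat).

Lemma lebesgue_hyperplane (i : 'I_n) (a : R) :
  lebesgue_euclid R n (@cube R n `&` [set t | (tnth t i : R) = a]) = 0%E.
Proof.
pose A k : set (measurableTypeR R) := if k == i then [set a] `&` `[0, 1]%classic else `[0, 1]%classic.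
have -> : @cube R n `&` [set t | (tnth t i : R) = a] = box A.
  apply/seteqP; split=> t.
    move=> [ct ta] k; rewrite /A; case: eqVneq => [->|_]; last by rewrite /= in_itv; exact: ct.
    by split=> //; rewrite /= in_itv; exact: ct.
  move=> At; split=> [k|]; last by have := At i; rewrite /A eqxx => -[].
  by have := At k; rewrite /A; case: eqVneq => _; rewrite /= in_itv //= => -[_].
rewrite (@lebesgue_box _ _ _ (fun k => if k == i then 0 else 1)).
- by rewrite (bigD1 i)//= eqxx mul0r.
- by move=> k; rewrite /A; case: ifP => // _; exact: measurableI.
- move=> k; rewrite /A; case: ifP => _; last exact: lebesgue_itv01.
  apply: (@subset_measure0 _ _ _ (@lebesgue_measure R) _ [set a]) => //.
  + exact: measurableI.
  + exact: lebesgue_measure_set1.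
Qed.

Lemma measurable_cell N (i : n.-tuple 'I_N) : measurable (@cell R n N i).
Proof.
rewrite (_ : cell i = box (fun k => `[(tnth i k)%:R / N%:R, (tnth i k).+1%:R / N%:R]%classic)).
  exact: measurable_box.
by apply/seteqP; split=> t + k => /(_ k); rewrite /= in_itv.
Qed.

(** A closed cell exceeds its half-open version only by points on upper faces, which lie in finitely
    many hyperplanes. The hypothesis holds for Lebesgue measure and, by uniformity of the margins,
    for copula measures. *)
Lemma measure_cell (m : {measure set (euclid R n) -> \bar R}) M (i : n.-tuple 'I_M.+1) S :
  (forall k a, m (@cube R n `&` [set t | (tnth t k : R) = a]) = 0%E) ->
  measurable S -> m (S `&` cell i) = m (S `&` pcell i).
Proof.
move=> m0 mS.
have M0 : 0 < M.+1%:R :> R by rewrite ltr0n.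
pose H k := @cube R n `&` [set t | (tnth t k : R) = (tnth i k).+1%:R / M.+1%:R].
have mH k : measurable (H k).
  apply: measurableI; first exact: measurable_cube.
  by have := measurable_tnth k measurableT
    (measurable_set1 ((tnth i k).+1%:R / M.+1%:R : measurableTypeR R)); rewrite setTI.
have mc := measurable_cell i; have mp := @measurable_pcell R _ _ i.
have pc : pcell i `<=` @cell R _ _ i.
  move=> t it k; have := it k; rewrite /slab /= itv_boundlr /= !bnd_simp => /andP[->].
  by case: (_ < _)%N; rewrite bnd_simp // => /ltW.
apply/eqP; rewrite eq_le; apply/andP; split; last first.
  by apply: le_measureW; [exact: measurableI..|exact: setIS].
apply: (@le_trans _ _ (m ((S `&` pcell i) `|` \big[setU/set0]_k H k))).
  apply: le_measureW; first exact: measurableI.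
    by apply: measurableU; [exact: measurableI|exact: bigsetU_measurable].
  move=> t [St ct]; have [tp|/existsNP[k tk]] := pselect (forall k, slab (tnth i k) (tnth t k : R)).
    by left.
  right; rewrite -bigcup_seq; exists k; first by rewrite /= mem_index_enum.
  split.
    move=> j; have /andP[jt tj] := ct j; apply/andP; split.
      by apply: le_trans jt; rewrite divr_ge0.
    by apply: (le_trans tj); rewrite ler_pdivrMr// mul1r ler_nat.
  have /andP[kt tk1] := ct k; apply/eqP; rewrite eq_le tk1 /= leNgt; apply/negP => lt.
  apply: tk; rewrite /slab /= itv_boundlr /= !bnd_simp kt /=.
  by case: (_ < _)%N; rewrite bnd_simp.
apply: le_trans (measureU2 _ _ _) _.
- exact: measurableI.
- exact: bigsetU_measurable.
rewrite -[leRHS]adde0; apply: leeD => //.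
apply: le_trans (measure_bigsetU_le _ _ _ _) _ => //.
by rewrite big1// => k _; exact: m0.
Qed.

End Cells.

Section CopulaMeasure.
Variables (R : realType) (n : nat) (C : euclid R n -> R).

Lemma copula_measure_distribution :
  is_copula C -> has_distribution_function (copula_measure C) C.
Proof. by move=> [exP _]; exact: xgetPex exP. Qed.

Lemma copula_measureE (P : probability (euclid R n) R) :
  has_distribution_function P C ->
  forall A, measurable A -> copula_measure C A = P A.
Proof.
move=> dP; apply: distribution_unique (dP).
exact: (@xgetPex {classic probability (euclid R n) R} _
  [set P | has_distribution_function P C] (ex_intro _ P dP)).
Qed.

End CopulaMeasure.

(** * The Markov kernel of a linkage *)

Section Kernel.
Variables (R : realType) (d : nat).
Local Notation lebd := (lebesgue_euclid R d).

Definition uniform_marginal (P : set (euclid R d.+1) -> \bar R) : Prop :=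
  forall E, measurable E -> P (tprod E setT) = lebd (E `&` @cube R d).

(** On lower boxes this is the linkage identity for C (x, 1); [lower_box_measure_unique] extends it
    to Borel sets. *)
Lemma linkage_marginal (C : euclid R d.+1 -> R) (P : probability (euclid R d.+1) R) :
  is_linkage C -> has_distribution_function P C -> uniform_marginal P.
Proof.
move=> [cC C1] dP E mE.
pose m1 := push_measure P (@measurable_tinit R d).
pose m2 : {measure set (euclid R d) -> \bar R} := mrestr lebd (@measurable_cube R d).
have mti A : measurable A -> measurable (@tinit (measurableTypeR R) d @^-1` A).
  by move=> mA; rewrite -[X in measurable X]setTI; exact: measurable_tinit.
have -> : tprod E setT = @tinit (measurableTypeR R) d @^-1` E.
  by rewrite /tprod preimage_setT setIT.
apply: (@lower_box_measure_unique R d m1 m2) => //.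
- apply: (@subset_measure0 _ _ _ P _ (~` @cube R d.+1)).
  + by apply: mti; apply: measurableC; exact: measurable_cube.
  + by apply: measurableC; exact: measurable_cube.
  + by move=> t /= nt ct; apply: nt; move: ct; rewrite cubeS => -[].
  + exact: distribution_setC dP.
- by rewrite /m2 /= /mrestr setICl measure0.
- rewrite (le_lt_trans (probability_le1 _ _)) ?ltry//.
  by apply: mti; exact: measurable_cube.
- move=> x cx.
  have mlx := measurable_lower_box x.
  rewrite /m2 /= /mrestr /pushforward setIidl; last first.
    move=> t lt k; have /andP[t0 tx] := lt k; rewrite t0 (le_trans tx)//.
    by have /andP[] := cx k.
  rewrite [RHS](lebesgue_lower_box cx) -C1// -(distribution_setI dP); last exact: mti.
  apply: etrans (dP.2 _ _); last first.
    apply: ord_lastP => [i|]; first by rewrite tnth_tsnoc_widen; exact: cx.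
    by rewrite tnth_tsnoc_max /= ler01 lexx.
  congr (P _); apply/seteqP; split=> t.
    move=> [lt ct]; apply: ord_lastP => [i|].
      by rewrite tnth_tsnoc_widen; have := lt i; rewrite tnth_mktuple.
    by rewrite tnth_tsnoc_max; exact: ct.
  move=> lt; split=> [i|].
    by have := lt (widen_ord (leqnSn d) i); rewrite tnth_tsnoc_widen tnth_mktuple.
  apply: ord_lastP => [i|]; last by have := lt ord_max; rewrite tnth_tsnoc_max.
  have := lt (widen_ord (leqnSn d) i); rewrite tnth_tsnoc_widen => /andP[-> ti].
  by rewrite (le_trans ti)//; have /andP[] := cx i.
Qed.

Lemma marginal_disintegration (P : probability (euclid R d.+1) R) :
  P (~` @cube R d.+1) = 0%E -> uniform_marginal P ->
  exists K : R.-pker (euclid R d) ~> measurableTypeR R,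
    (forall x, K x `[0, 1]%classic = 1%E) /\
    forall E (F : set (measurableTypeR R)), measurable E -> E `<=` @cube R d -> measurable F ->
      P (tprod E F) = (\int[lebd]_(x in E) K x F)%E.
Proof.
move=> P0 mP.
pose m2 : {measure set (euclid R d) -> \bar R} := mrestr lebd (@measurable_cube R d).
have msplit : measurable_fun setT
    (fun t : euclid R d.+1 => (tinit t, tlast t) : euclid R d * measurableTypeR R).
  apply: measurable_fun_pair; [exact: measurable_tinit|exact: measurable_tlast].
pose P' := push_measure P msplit.
have P'E E F : P' (E `*` F) = P (tprod E F) by [].
have [|||K [K1 KE]] := @disintegration _ _ R m2 P'.
- by rewrite /m2 /= /mrestr setTI lebesgue_cube ltry.
- by move=> E mE; rewrite P'E mP.
- rewrite P'E; apply: (@subset_measure0 _ _ _ P _ (~` @cube R d.+1)) => //.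
  + by apply: measurable_tprod => //; exact: measurableC.
  + by apply: measurableC; exact: measurable_cube.
  + by move=> t [_ /= tl]; rewrite cubeS => -[_].
exists K; split=> // E F mE Ec mF; rewrite -P'E KE//.
apply: eq_measure_integral => A mA AE; rewrite /m2 /= /mrestr setIidl//.
exact: subset_trans Ec.
Qed.

(** Since some version of the kernel exists, the choice in [markov_kernel] is such a version and not
    the default. The hypotheses are put on a measure [P] so that the lemma applies to the
    checkerboard through its explicit measure. *)
Lemma markov_kernelP (C : euclid R d.+1 -> R) (P : probability (euclid R d.+1) R) :
  has_distribution_function P C -> uniform_marginal P ->
  forall E (F : set (measurableTypeR R)), measurable E -> E `<=` @cube R d -> measurable F ->
    F `<=` `[0, 1]%classic ->
    P (tprod E F) = (\int[lebd]_(x in E) markov_kernel C x F)%E.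
Proof.
move=> dP mP.
have [K [K1 KE]] := marginal_disintegration (distribution_setC dP) mP.
have exK : exists K, is_markov_kernel C K.
  exists K; split=> [x _|E F mE Ec mF F01]; first exact: K1.
  by rewrite tsnoc_image (copula_measureE dP) ?KE//; exact: measurable_tprod.
have [_ mkE] := @xgetPex {classic R.-pker (euclid R d) ~> measurableTypeR R} 
  (kdirac (measurable_cst (point : measurableTypeR R))) [set K | is_markov_kernel C K] exK.
move=> E F mE Ec mF F01; rewrite -mkE// tsnoc_image (copula_measureE dP)//.
exact: measurable_tprod.
Qed.

End Kernel.

Section CodeSums.
Variables (R : realType) (n M : nat) (m : {measure set (euclid R n) -> \bar R}).

Lemma measure_code (S : set (euclid R n)) (U : pred (n.-tuple 'I_M.+1)) :
  measurable S ->
  m (S `&` [set t | cube t /\ U (code M t)]) = (\sum_(i | U i) m (S `&` pcell i))%E.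
Proof.
move=> mS; rewrite cube_codeE -measure_disjoint_bigsetU.
- by rewrite big_distrr.
- exact: index_enum_uniq.
- by move=> i; apply: measurableI => //; exact: measurable_pcell.
- by move=> i j [t [[_ it] [_ jt]]]; apply: (@pcell_inj R M n); exists t.
Qed.

Lemma measure_cube_sum (S : set (euclid R n)) : measurable S ->
  m (S `&` @cube R n) = (\sum_(i : n.-tuple 'I_M.+1) m (S `&` pcell i))%E.
Proof.
move=> mS; rewrite -measure_code//; congr (m (S `&` _)).
by apply/seteqP; split=> t // [].
Qed.

End CodeSums.

(** * The checkerboard measure as a combination of Lebesgue measures on cells *)

Section Checkerboard.
Variables (R : realType) (d M : nat) (C : euclid R d.+1 -> R).
Hypothesis linkC : is_linkage C.
Local Notation N := (M.+1).
Local Notation n := (d.+1).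
Local Notation lebn := (lebesgue_euclid R n).
Local Notation mu := (copula_measure C).

Definition weight (i : n.-tuple 'I_N) : R := fine (mu (pcell i)).

Lemma weightE i : mu (pcell i) = (weight i)%:E.
Proof. by rewrite fineK// fin_num_measure//; exact: measurable_pcell. Qed.

Lemma weight_ge0 i : 0 <= weight i.
Proof. by rewrite fine_ge0. Qed.

Let dmu : has_distribution_function mu C.
Proof. by apply: copula_measure_distribution; case: linkC. Qed.

Lemma weight_sum (S : set (euclid R n)) (U : pred (n.-tuple 'I_N)) :
  (forall t, @cube R n t -> S t <-> U (code M t)) -> measurable S ->
  mu S = (\sum_(i | U i) weight i)%:E.
Proof.
move=> SU mS; rewrite -(distribution_setI dmu mS).
rewrite (_ : S `&` _ = setT `&` [set t | cube t /\ U (code M t)]); last first.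
  apply/seteqP; split=> t; first by move=> [St ct]; split=> //; split=> //; apply/SU.
  by move=> [_ [ct Ut]]; split=> //; apply/SU.
rewrite measure_code// -sumEFin; apply: eq_bigr => i _.
by rewrite setTI; exact: weightE.
Qed.

(** The factor N^n is the inverse volume of a cell, so each cell receives its mass under [mu] and
    the total is 1. This gives explicit access to the measure behind [checkerboard], which is
    defined only as a distribution function. *)
Lemma checkerboard_measure : exists Q : probability (euclid R n) R,
  has_distribution_function Q (checkerboard N C) /\
  forall S, measurable S ->
    Q S = (\sum_i ((N ^ n)%:R * weight i)%:E * lebn (S `&` pcell i))%E.
Proof.
have w0 i : 0 <= (N ^ n)%:R * weight i by rewrite mulr_ge0// weight_ge0.
have [m mE] := weighted_measure lebn w0 (@measurable_pcell R M n).
have mcube : measurable (@cube R n) := @measurable_cube R n.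
have M0 : (N ^ n)%:R != 0 :> R by rewrite pnatr_eq0 expn_eq0.
have mT : m setT = 1%E.
  rewrite mE (eq_bigr (fun i => (weight i)%:E)); last first.
    move=> i _; rewrite setTI lebesgue_pcell -EFinM; congr EFin.
    by rewrite mulrAC mulfV// mul1r.
  by rewrite sumEFin -(@weight_sum setT xpredT)// probability_setT.
have [Q QE] := measure_probability mT.
exists Q; split=> [|S mS]; last by rewrite QE mE.
have Q1 : Q (@cube R n) = 1%E.
  rewrite -(probability_setT Q) !QE !mE; apply: eq_bigr => i _.
  by rewrite setTI setIidr// => t /pcellP[].
split=> // x cx.
have mlx := measurable_lower_box x.
rewrite /checkerboard.
suff -> : (\int[lebn]_(t in lower_box x) checkerboard_density N C t)%E = Q (lower_box x).
  by rewrite fineK// fin_num_measure.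
rewrite /checkerboard_density QE mE.
(* Closed cells become half-open twice: here in the mass under [mu], and in the last line in the
   Lebesgue measure. *)
have ci t i : (mu (@cell R n N i) * (\1_(@cell R n N i) t)%:E)%E =
    ((weight i)%:E * (\1_(@cell R n N i) t)%:E)%E.
  congr (_ * _)%E; rewrite -weightE -(setTI (cell i)) -[pcell i]setTI.
  apply: measure_cell => // k a; exact: (copula_hyperplane dmu linkC.1).
under eq_integral do under eq_bigr do rewrite ci.
have mind i : measurable_fun (lower_box x) (fun t => ((\1_(@cell R n N i) t)%:E : \bar R)).
  by apply/measurable_EFinP; apply: measurable_indic; exact: measurable_cell.
have mwind i : measurable_fun (lower_box x) (fun t => ((weight i)%:E * (\1_(@cell R n N i) t)%:E)%E).
  exact: measurable_funeM.
rewrite ge0_integralZl//; last 2 first.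
- exact: emeasurable_sum.
- by move=> t _; apply: sume_ge0 => i _; rewrite mule_ge0// lee_fin weight_ge0.
rewrite ge0_integral_sum//; last first.
  by move=> i t _; rewrite mule_ge0// lee_fin weight_ge0.
rewrite ge0_sume_distrr; last first.
  by move=> i _; apply: integral_ge0 => t _; rewrite mule_ge0// lee_fin weight_ge0.
apply: eq_bigr => i _; rewrite ge0_integralZl//; last by rewrite lee_fin weight_ge0.
rewrite integral_indic//; last exact: measurable_cell.
rewrite muleA -EFinM; congr (_ * _)%E.
rewrite setIC; apply: measure_cell => // k a; exact: lebesgue_hyperplane.
Qed.

End Checkerboard.

(** * Cell means *)

Section Pcell.
Variables (R : realType) (d M : nat).

Lemma code_tinit (t : euclid R d.+1) : code M (tinit t) = tinit (code M t).
Proof. by apply: eq_from_tnth => k; rewrite !tnth_mktuple. Qed.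

Lemma pcellS (i : d.+1.-tuple 'I_M.+1) :
  @pcell R M d.+1 i = tprod (pcell (tinit i)) (slab (tlast i)).
Proof.
by rewrite /pcell boxS; congr tprod; congr box; apply/funext => k; rewrite tnth_mktuple.
Qed.

Lemma cube_integral_sum (f : euclid R d -> \bar R) :
  measurable_fun setT f -> (forall x, 0 <= f x)%E ->
  (\int[lebesgue_euclid R d]_(x in @cube R d) f x =
   \sum_(a : d.-tuple 'I_M.+1) \int[lebesgue_euclid R d]_(x in pcell a) f x)%E.
Proof.
move=> mf f0.
have -> : @cube R d = \big[setU/set0]_(a : d.-tuple 'I_M.+1) pcell a.
  by rewrite -(@cube_codeE R M d xpredT); apply/seteqP; split=> t // [].
apply: ge0_integral_bigsetU => //.
- by move=> a; exact: measurable_pcell.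
- exact: index_enum_uniq.
- by move=> a b _ _; exact: pcell_inj.
- exact: measurable_funTS.
Qed.

End Pcell.

Section Estimate.
Variables (R : realType) (d M : nat) (C : euclid R d.+1 -> R).
Hypothesis linkC : is_linkage C.
Local Notation N := (M.+1).
Local Notation lebd := (lebesgue_euclid R d).
Local Notation mu := (copula_measure C).
Local Notation lam := (@lebesgue_measure R).

Let dmu : has_distribution_function mu C.
Proof. by apply: copula_measure_distribution; case: linkC. Qed.

(** The fraction of the slab j that F fills. For F = [0, y] it is 1 on slabs below that of y, 0 on
    slabs above, and the linear interpolation in between. *)
Definition share (F : set (measurableTypeR R)) (j : 'I_N) : R :=
  N%:R * fine (lam (F `&` slab j)).

Lemma lam_shareE F j : measurable F -> lam (F `&` slab j) = (N%:R^-1 * share F j)%:E.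
Proof.
move=> mF; rewrite /share mulKf ?pnatr_eq0// fineK// ge0_fin_numE//.
rewrite (@le_lt_trans _ _ (lam (slab j)))// ?lebesgue_slab ?ltry//.
by rewrite -(lebesgue_slab R j); apply: le_measureW => //; [apply: measurableI => //|]; exact: measurable_slab.
Qed.

Lemma share01 F j : measurable F -> 0 <= share F j <= 1.
Proof.
move=> mF; have N0 : 0 < N%:R^-1 :> R by rewrite invr_gt0 ltr0n.
apply/andP; split; first by rewrite /share mulr_ge0// fine_ge0.
rewrite -(ler_pM2l N0) mulr1 -lee_fin -lam_shareE// -(lebesgue_slab R j).
by apply: le_measureW => //; [apply: measurableI => //|]; exact: measurable_slab.
Qed.

Lemma share_sub F j : slab j `<=` F -> share F j = 1.
Proof.
by move=> jF; rewrite /share (setIidr jF) lebesgue_slab /= mulfV.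
Qed.

Lemma share_disjoint F j : F `&` slab j = set0 -> share F j = 0.
Proof. by rewrite /share => ->; rewrite measure0 mulr0. Qed.

(* The mass that the checkerboard measure gives to the product of the cell a and F. *)
Definition slice (F : set (measurableTypeR R)) (a : d.-tuple 'I_N) : R :=
  \sum_(i | tinit i == a) weight C i * share F (tlast i).

Lemma slice_ge0 F a : measurable F -> 0 <= slice F a.
Proof.
move=> mF; apply: sumr_ge0 => i _; rewrite mulr_ge0 ?weight_ge0//.
by have /andP[] := share01 (tlast i) mF.
Qed.

Variable Q : probability (euclid R d.+1) R.
Hypothesis QE : forall S, measurable S -> Q S =
  (\sum_(i : d.+1.-tuple 'I_N) ((N ^ d.+1)%:R * weight C i)%:E *
     lebesgue_euclid R d.+1 (S `&` pcell i))%E.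

(** Cells are grouped by their first d indices, and on each cell the measure is a product. The
    formula exhibits N^d [slice F a] as the value on the cell a of a kernel for the checkerboard. *)
Lemma checkerboard_rectangle E F : measurable E -> measurable F ->
  Q (tprod E F) = (\sum_a ((N ^ d)%:R * slice F a)%:E * lebd (E `&` pcell a))%E.
Proof.
move=> mE mF; rewrite QE; last exact: measurable_tprod.
rewrite (partition_big (@tinit _ d) xpredT)//=; apply: eq_bigr => a _.
rewrite mulr_sumr -sumEFin ge0_sume_distrl; last first.
  move=> i _; rewrite lee_fin; apply: mulr_ge0 => //.
  apply: mulr_ge0; first exact: weight_ge0.
  by have /andP[] := share01 (tlast i) mF.
apply: eq_bigr => i /eqP <-.
have -> : tprod E F `&` pcell i = tprod (E `&` pcell (tinit i)) (F `&` slab (tlast i)).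
  by rewrite pcellS; apply/seteqP; split=> t [[? ?] [? ?]].
rewrite lebesgue_tprod; last 2 first.
- by apply: measurableI => //; exact: measurable_pcell.
- by apply: measurableI => //; exact: measurable_slab.
rewrite lam_shareE// muleCA muleC -EFinM; congr (_%:E * _)%E.
have : N%:R != 0 :> R by rewrite pnatr_eq0.
by rewrite expnS natrM; move: (N%:R : R) => z z0; field.
Qed.

Lemma slice_setT a : slice setT a = (N ^ d)%:R^-1.
Proof.
rewrite /slice (eq_bigr (weight C)); last first.
  by move=> i _; rewrite share_sub ?mulr1.
apply/EFin_inj; rewrite -(lebesgue_pcell R a).
rewrite -(@weight_sum R d M C linkC (tprod (pcell a) setT)).
- rewrite (linkage_marginal linkC dmu); last exact: measurable_pcell.
  by rewrite setIidl// => t /pcellP[].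
- move=> t ct; rewrite -code_tinit; split; first by move=> [/pcellP[_ ->]].
  move=> /eqP ta; split=> //; apply/pcellP; split=> //.
  by move: ct; rewrite cubeS => -[].
- by apply: measurable_tprod => //; exact: measurable_pcell.
Qed.

Lemma checkerboard_marginal : uniform_marginal Q.
Proof.
move=> E mE; rewrite checkerboard_rectangle//.
rewrite (measure_cube_sum M)//; apply: eq_bigr => a _.
by rewrite slice_setT mulfV ?mul1e// pnatr_eq0 expn_eq0.
Qed.

Section Level.
Variable y : R.
Hypothesis y01 : 0 <= y <= 1.
Local Notation F := (`[0, y]%classic : set (measurableTypeR R)).

(** Both terms lie between the mass above the cell a in the slabs strictly below that of y and the
    same mass with the slab of y included. Their difference is at most the mass in that one slab.
    Summed over a, this is the [mu]-mass of a whole slab, hence at most 1/N by the uniform last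
    margin. *)
Lemma slice_error :
  \sum_a `|slice F a - fine (mu (tprod (pcell a) F))| <= N%:R^-1.
Proof.
have mF : measurable F by [].
pose lo a := \sum_(i : d.+1.-tuple 'I_N | (tinit i == a) && (tlast i < code1 M y)%N) weight C i.
pose hi a := \sum_(i : d.+1.-tuple 'I_N | (tinit i == a) && (tlast i <= code1 M y)%N) weight C i.
pose gap a := \sum_(i : d.+1.-tuple 'I_N | (tinit i == a) && (tlast i == code1 M y)) weight C i.
have hiE a : hi a = lo a + gap a.
  rewrite /hi (bigID (fun i : d.+1.-tuple 'I_N => (tlast i < code1 M y)%N))/=; congr (_ + _).
    by apply: eq_bigl => i; case: (tinit i == a) => //=; lia.
  apply: eq_bigl => i; case: (tinit i == a) => //=.
  by rewrite -(inj_eq val_inj) /=; lia.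
have slab_lt (j : 'I_N) : (j < code1 M y)%N -> slab j `<=` F.
  move=> jy t /slabP[/andP[t0 _] tj]; rewrite /= in_itv /= t0 /= leNgt; apply/negP => /ltW.
  by move=> /(code1_mono M); rewrite tj leqNgt jy.
have slab_gt (j : 'I_N) : (code1 M y < j)%N -> F `&` slab j = set0.
  move=> jy; apply/seteqP; split=> // t [+ /slabP[_ tj]].
  by rewrite /= in_itv /= => /andP[_ /(code1_mono M)]; rewrite tj leqNgt jy.
have slo a : lo a <= slice F a.
  rewrite /slice (bigID (fun i : d.+1.-tuple 'I_N => (tlast i < code1 M y)%N))/=.
  rewrite -[leLHS]addr0; apply: lerD.
    by apply: ler_sum => i /andP[_ iy]; rewrite share_sub ?mulr1//; exact: slab_lt.
  apply: sumr_ge0 => i _; rewrite mulr_ge0 ?weight_ge0//.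
  by have /andP[] := share01 (tlast i) mF.
have shi a : slice F a <= hi a.
  rewrite /slice (bigID (fun i : d.+1.-tuple 'I_N => (tlast i <= code1 M y)%N))/=.
  rewrite -[leRHS]addr0; apply: lerD.
    apply: ler_sum => i _; rewrite -[leRHS]mulr1 ler_wpM2l ?weight_ge0//.
    by have /andP[] := share01 (tlast i) mF.
  rewrite big1// => i /andP[_ iy]; rewrite share_disjoint ?mulr0//.
  by apply: slab_gt; rewrite ltnNge.
have mtp a : measurable (tprod (@pcell R M d a) F).
  by apply: measurable_tprod => //; exact: measurable_pcell.
have mlast (U : pred 'I_N) : measurable [set t : euclid R d.+1 | @cube R d.+1 t /\ U (tlast (code M t))].
  rewrite (@cube_codeE R M d.+1 (fun i => U (tlast i))).
  by apply: bigsetU_measurable => i _; exact: measurable_pcell.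
pose S (U : pred 'I_N) (a : d.-tuple 'I_N) : set (euclid R d.+1) := (@tinit (measurableTypeR R) d @^-1` pcell a) `&`
  [set t | @cube R d.+1 t /\ U (tlast (code M t))].
have mS U a : measurable (S U a).
  apply: measurableI => //; rewrite -[X in measurable X]setTI; apply: measurable_tinit => //.
  exact: measurable_pcell.
have SE U a : mu (S U a) = (\sum_(i : d.+1.-tuple 'I_N | (tinit i == a) && U (tlast i)) weight C i)%:E.
  apply: weight_sum => // t ct; rewrite -code_tinit; split.
    by move=> [/pcellP[_ ->] [_ ->]]; rewrite eqxx.
  move=> /andP[/eqP ta Ut]; split=> //; apply/pcellP; split=> //.
  by move: ct; rewrite cubeS => -[].
have tlast_code (t : euclid R d.+1) : tlast (code M t) = code1 M (tlast t : R).
  by rewrite /tlast tnth_mktuple.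
have nlo a : lo a <= fine (mu (tprod (pcell a) F)).
  rewrite -lee_fin fineK ?fin_num_measure// -(SE (fun j => (j < code1 M y)%N)).
  apply: le_measureW => // t [ta [ct ty]]; split=> //.
  apply: (@slab_lt (tlast (code M t))) => //; rewrite tlast_code; apply/slabP.
  by split=> //; exact: ct.
have nhi a : fine (mu (tprod (pcell a) F)) <= hi a.
  rewrite -lee_fin fineK ?fin_num_measure// -(SE (fun j => (j <= code1 M y)%N)).
  rewrite -(distribution_setI dmu (mtp a)).
  apply: le_measureW => //; first by apply: measurableI => //; exact: measurable_cube.
  move=> t [[ta ty] ct]; split=> //; split=> //; rewrite tlast_code.
  by apply: code1_mono; move: ty; rewrite /= in_itv /= => /andP[].
apply: (@le_trans _ _ (\sum_a gap a)).
  apply: ler_sum => a _; rewrite ler_norml; have := slo a; have := shi a.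
  have := nlo a; have := nhi a; rewrite !hiE; lra.
rewrite -lee_fin.
have -> : (\sum_a gap a)%:E = mu [set t | slab (code1 M y) (tnth t ord_max)].
  rewrite (@weight_sum R d M C linkC _ (fun i => tlast i == code1 M y)).
  - by rewrite (partition_big (@tinit _ d) xpredT)//=; congr EFin;
      apply: eq_bigr => a _; apply: eq_bigl => i; rewrite andbC.
  - move=> t ct; rewrite tlast_code; split=> [/slabP[_ ->]//|/eqP te].
    by apply/slabP; split=> //; exact: ct.
  - have := measurable_tnth (@ord_max d) measurableT (@measurable_slab R _ (code1 M y)).
    by rewrite setTI.
rewrite (copula_margin dmu linkC.1)//; last exact: measurable_slab.
rewrite -(@lebesgue_slab R _ (code1 M y)); apply: le_measureW => //.
- by apply: measurableI => //; exact: measurable_slab.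
- exact: measurable_slab.
Qed.

End Level.

End Estimate.

Section Step.
Variables (R : realType) (d M : nat).
Implicit Types h : d.-tuple 'I_M.+1 -> R.

(** On the cube this is h composed with [code] ([stepE]); as a sum of indicators it is visibly
    measurable and easy to integrate. *)
Definition step h (x : euclid R d) : R := \sum_a h a * \1_(pcell a) x.

Lemma stepE h x : @cube R d x -> step h x = h (code M x).
Proof.
move=> cx; rewrite /step (bigD1 (code M x))//= big1 ?addr0; last first.
  move=> a ax; rewrite indicE memNset ?mulr0// => /pcellP[_ xa].
  by rewrite xa eqxx in ax.
by rewrite indicE mem_set ?mulr1//; apply/pcellP.
Qed.

Lemma measurable_step h : measurable_fun setT (step h).
Proof.
apply: measurable_sum => a; apply: measurable_funM => //.
by apply: measurable_indic; exact: measurable_pcell.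
Qed.

Lemma integral_step h E : (forall a, 0 <= h a) -> measurable E -> E `<=` @cube R d ->
  (\int[lebesgue_euclid R d]_(x in E) (step h x)%:E =
   \sum_a (h a)%:E * lebesgue_euclid R d (E `&` pcell a))%E.
Proof.
move=> h0 mE Ec; under eq_integral do rewrite /step -sumEFin.
have mi a : measurable_fun E (fun x => (\1_(@pcell R M d a) x)%:E : \bar R).
  by apply/measurable_EFinP; apply: measurable_indic; exact: measurable_pcell.
rewrite ge0_integral_sum//; last 2 first.
- by move=> a; under eq_fun do rewrite EFinM; exact: measurable_funeM.
- by move=> a x _; rewrite lee_fin mulr_ge0.
apply: eq_bigr => a _; under eq_integral do rewrite EFinM.
rewrite ge0_integralZl//; last first.
  by rewrite lee_fin.
rewrite integral_indic//; last exact: measurable_pcell.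
by rewrite setIC.
Qed.

End Step.

Section CellEstimate.
Variables (R : realType) (d M : nat) (C : euclid R d.+1 -> R).
Hypothesis linkC : is_linkage C.
Local Notation N := (M.+1).
Local Notation lebd := (lebesgue_euclid R d).
Local Notation mu := (copula_measure C).
Variable y : R.
Hypothesis y01 : 0 <= y <= 1.
Local Notation F := (`[0, y]%classic : set (measurableTypeR R)).
Variable f : euclid R d -> R.
Hypotheses (mf : measurable_fun setT f) (f01 : forall x, 0 <= f x <= 1).
Hypothesis fE : forall E, measurable E -> E `<=` @cube R d ->
  mu (tprod E F) = (\int[lebd]_(x in E) (f x)%:E)%E.
Variable g : d.-tuple 'I_N -> R.

(** The distance from f to g enters twice: once directly, and once as the distance from g to the
    cell means of f, where on each cell the absolute value of the integral of f - g is bounded by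
    the integral of its absolute value. Passing from the cell means to [slice] costs 1/N by
    [slice_error]. *)
Lemma cell_estimate :
  (\int[lebd]_(x in @cube R d) `|step (fun a : d.-tuple 'I_N => (N ^ d)%:R * slice C F a) x - f x|%:E
   <= N%:R^-1%:E + (\int[lebd]_(x in @cube R d) `|f x - g (code M x)|%:E
                  + \int[lebd]_(x in @cube R d) `|f x - g (code M x)|%:E))%E.
Proof.
pose h (a : d.-tuple 'I_N) := (N ^ d)%:R * slice C F a.
have mp (a : d.-tuple 'I_N) : measurable (@pcell R M d a) := @measurable_pcell R M d a.
have -> : (\int[lebd]_(x in @cube R d) `|f x - g (code M x)|%:E =
    \int[lebd]_(x in @cube R d) `|f x - step g x|%:E)%E.
  by apply: eq_integral => x /[!inE] cx; rewrite stepE.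
have mstep (k : d.-tuple 'I_N -> R) : measurable_fun setT (fun x => (`|f x - step k x|%:E : \bar R)).
  apply/measurable_EFinP; apply: measurableT_comp => //; apply: measurable_funB => //.
  exact: measurable_step.
under eq_integral do rewrite distrC.
rewrite !(@cube_integral_sum R d M)//.
pose e (a : d.-tuple 'I_N) := (\int[lebd]_(x in pcell a) `|f x - step g x|%:E)%E.
have onp (a : d.-tuple 'I_N) (k : d.-tuple 'I_N -> R) x : pcell a x -> step k x = k a.
  by move=> /pcellP[cx xa]; rewrite stepE// xa.
have lp (a : d.-tuple 'I_N) (c : R) : (\int[lebd]_(x in pcell a) c%:E = (c * (N ^ d)%:R^-1)%:E)%E.
  by rewrite (integral_cst _ (mp a)) EFinM -(lebesgue_pcell R a).
have intf (a : d.-tuple 'I_N) : lebd.-integrable (pcell a) (EFin \o f).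
  apply/integrableP; split; first by apply/measurable_EFinP; exact: measurable_funTS.
  apply: (@le_lt_trans _ _ (\int[lebd]_(x in pcell a) 1%:E)%E); last by rewrite lp ltry.
  apply: ge0_le_integralW => x _ //=; have /andP[f0 f1] := f01 x.
  by rewrite lee_fin ger0_norm.
have intc (a : d.-tuple 'I_N) (c : R) : lebd.-integrable (pcell a) (cst c%:E).
  apply/integrableP; split; first exact: measurable_cst.
  by rewrite /= (lp _ `|c|) ltry.
have ea (a : d.-tuple 'I_N) : (`|slice C F a - fine (mu (tprod (pcell a) F))|%:E + (e a + e a) >=
    \int[lebd]_(x in pcell a) `|f x - step h x|%:E)%E.
  apply: (@le_trans _ _ (\int[lebd]_(x in pcell a) (`|h a - g a|%:E + `|f x - step g x|%:E))%E).
    apply: ge0_le_integralW => x px; first by rewrite lee_fin.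
    rewrite -EFinD lee_fin !(onp a)// (_ : f x - h a = (g a - h a) + (f x - g a)).
      by rewrite (le_trans (ler_normD _ _))// lerD2r distrC.
    by ring.
  rewrite ge0_integralD//; last 1 first.
  - exact: measurable_funTS.
  rewrite lp [leRHS]addeA; apply: leeD => //.
  have -> : `|h a - g a| * (N ^ d)%:R^-1 = `|slice C F a - g a * (N ^ d)%:R^-1|.
    rewrite -[(N ^ d)%:R^-1 in LHS]ger0_norm ?invr_ge0// -normrM; congr `|_|.
    have : (N ^ d)%:R != 0 :> R by rewrite pnatr_eq0 expn_eq0.
    by rewrite /h; move: ((N ^ d)%:R : R) => z z0; field.
  apply: (@le_trans _ _ (`|slice C F a - fine (mu (tprod (pcell a) F))|%:E +
     `|fine (mu (tprod (pcell a) F)) - g a * (N ^ d)%:R^-1|%:E)%E).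
    by rewrite -EFinD lee_fin ler_distD.
  apply: leeD => //.
  have ca : pcell a `<=` @cube R d by move=> t /pcellP[].
  have muE := fE (mp a) ca.
  have -> : `|fine (mu (tprod (pcell a) F)) - g a * (N ^ d)%:R^-1|%:E =
      `|\int[lebd]_(x in pcell a) ((f x)%:E - (g a)%:E)|%E.
    have := integralB (mp a) (intf a) (intc a (g a)).
    rewrite /= lp -muE => ->.
    have : mu (tprod (pcell a) F) \is a fin_num.
      by rewrite fin_num_measure//; exact: measurable_tprod.
    by case: (mu _).
  apply: le_trans (le_abse_integral _ _ _) _ => //.
    apply: emeasurable_funB => //; apply/measurable_EFinP; exact: measurable_funTS.
  apply: ge0_le_integralW => x px //.
  by rewrite (onp a).
apply: (@le_trans _ _ (\sum_a (`|slice C F a - fine (mu (tprod (pcell a) F))|%:E + (e a + e a)))%E).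
  exact: lee_sum.
rewrite !big_split /=; apply: leeD => //.
by rewrite sumEFin lee_fin; exact: slice_error.
Qed.

End CellEstimate.

(** u - v lies between u1 - v2 and u2 - v1, and exchanging v1 and v2 costs e. Only the interval for
    v has to be short: between grid levels only the kernel of C is controlled, not that of the
    checkerboard. *)
Lemma dist_monotone (R : realType) (u u1 u2 v v1 v2 e : R) :
  u1 <= u -> u <= u2 -> v1 <= v -> v <= v2 -> v2 <= v1 + e ->
  `|u - v| <= `|u1 - v1| + `|u2 - v2| + e.
Proof.
move=> u1u uu2 v1v vv2 ve.
have h1 := ler_norm (- (u1 - v1)); have h2 := ler_norm (u2 - v2).
have h3 := normr_ge0 (u1 - v1); have h4 := normr_ge0 (u2 - v2).
by rewrite normrN in h1; rewrite ler_norml; apply/andP; split; lra.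
Qed.

(** * Convergence at each level y, and integration over y *)

Section Convergence.
Variables (R : realType) (d : nat) (C : euclid R d.+1 -> R).
Hypothesis linkC : is_linkage C.
Local Notation lebd := (lebesgue_euclid R d).
Local Notation mu := (copula_measure C).
Local Notation ray y := (`[0, y]%classic : set (measurableTypeR R)).

Let dmu : has_distribution_function mu C.
Proof. by apply: copula_measure_distribution; case: linkC. Qed.

Definition level_distance N (y : R) : \bar R :=
  (\int[lebd]_(x in @cube R d)
     `|markov_kernel (checkerboard N C) x (ray y) - markov_kernel C x (ray y)|)%E.

Lemma kernel_le1 (K : R.-pker (euclid R d) ~> measurableTypeR R) x F :
  measurable F -> (K x F <= 1)%E.
Proof.
move=> mF; rewrite -(@prob_kernel _ _ _ _ R K x); exact: le_measureW.
Qed.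

Lemma kernel_fineE (K : R.-pker (euclid R d) ~> measurableTypeR R) x F :
  measurable F -> K x F = (fine (K x F))%:E.
Proof.
move=> mF; rewrite fineK// ge0_fin_numE//.
by apply: le_lt_trans (kernel_le1 K x mF) _; rewrite ltry.
Qed.

Lemma ray_sub01 (y : R) : y <= 1 -> ray y `<=` `[0, 1]%classic.
Proof.
by move=> y1 t; rewrite /= !in_itv /= => /andP[-> ty]; rewrite (le_trans ty).
Qed.

Lemma level_cvg (y : R) : 0 <= y <= 1 -> forall e : R, 0 < e ->
  exists M0, forall M, (M0 <= M)%N -> (level_distance M.+1 y <= e%:E)%E.
Proof.
move=> y01 e e0.
have mF : measurable (ray y) by [].
have F01 : ray y `<=` `[0, 1]%classic by apply: ray_sub01; case/andP: y01.
pose f x := fine (markov_kernel C x (ray y)).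
have mf : measurable_fun setT f.
  by apply: measurableT_comp => //; exact: measurable_kernel.
have f01 x : 0 <= f x <= 1.
  by rewrite fine_ge0//= -lee_fin -kernel_fineE// kernel_le1.
have mcube := @measurable_cube R d.
have fE E : measurable E -> E `<=` @cube R d ->
    mu (tprod E (ray y)) = (\int[lebd]_(x in E) (f x)%:E)%E.
  move=> mE Ec; rewrite (markov_kernelP dmu (linkage_marginal linkC dmu))//.
  by apply: eq_integral => x _; rewrite -kernel_fineE.
(* The error of g counts twice in [cell_estimate], which uses e/2; the other e/2 absorbs 1/N through
   the threshold [Num.truncn (2 / e)]. *)
have e40 : 0 < e / 4 by rewrite divr_gt0.
have [M1 M1P] := code_approximation mf f01 e40.
exists (maxn M1 (Num.truncn (2 / e))) => M; rewrite geq_max => /andP[/M1P[g ge] eM].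
have [Q [dQ QE]] := checkerboard_measure M linkC.
have mQ := checkerboard_marginal linkC QE.
pose h (a : d.-tuple 'I_M.+1) := (M.+1 ^ d)%:R * slice C (ray y) a.
have h0 a : 0 <= h a by rewrite mulr_ge0// slice_ge0.
(* The chosen kernel of the checkerboard is known only through its integrals, so it is identified
   with the explicit step function almost everywhere on the cube. *)
have KE : ae_eq lebd (@cube R d) (fun x => markov_kernel (checkerboard M.+1 C) x (ray y))
    (fun x => (step h x)%:E).
  apply: integral_ae_eq => //.
  - apply/integrableP; split; first by apply: measurable_funTS; exact: measurable_kernel.
    apply: (@le_lt_trans _ _ (\int[lebd]_(x in @cube R d) 1)%E).
      by apply: ge0_le_integralW => // x _; rewrite gee0_abs// kernel_le1.
    by rewrite integral_cst// mul1e lebesgue_cube ltry.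
  - by apply/measurable_EFinP; apply: measurable_funTS; exact: measurable_step.
  - move=> E Ec mE; rewrite -(markov_kernelP dQ mQ)// integral_step//.
    exact: (checkerboard_rectangle QE).
rewrite /level_distance.
have -> : (\int[lebd]_(x in @cube R d)
    `|markov_kernel (checkerboard M.+1 C) x (ray y) - markov_kernel C x (ray y)| =
    \int[lebd]_(x in @cube R d) `|step h x - f x|%:E)%E.
  apply: ae_eq_integral => //.
  - apply: measurableT_comp => //; apply: emeasurable_funB; apply: measurable_funTS; exact: measurable_kernel.
  - apply/measurable_EFinP; apply: measurableT_comp => //; apply: measurable_funTS.
    by apply: measurable_funB => //; exact: measurable_step.
  - by apply: filterS KE => x /[apply] ->; rewrite (@kernel_fineE (markov_kernel C)).
apply: le_trans (cell_estimate linkC y01 mf f01 fE g) _.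
have -> : e = e / 2 + (e / 4 + e / 4) by field.
rewrite !EFinD; apply: leeD; last exact: leeD.
rewrite lee_fin -[e / 2]invrK lef_pV2 ?posrE ?invr_gt0 ?divr_gt0// invf_div.
by apply/ltW; apply: lt_le_trans (truncnS_gt _) _; rewrite ler_nat.
Qed.

(* Distribution functions are monotone, so the distance at level y is controlled
   by the two neighbouring grid levels and the mass of mu between them. *)
Lemma level_grid N L (y : R) : 0 <= y <= 1 ->
  exists j : 'I_L.+1, (level_distance N y <=
    level_distance N (j%:R / L.+1%:R) + level_distance N (j.+1%:R / L.+1%:R)
    + L.+1%:R^-1%:E)%E.
Proof.
move=> y01; exists (code1 L y); set j := code1 L y.
have L0 : 0 < L.+1%:R :> R by rewrite ltr0n.
pose a : R := j%:R / L.+1%:R; pose b : R := j.+1%:R / L.+1%:R.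
have /andP[ay yb] : a <= y <= b.
  have /slabP : 0 <= y <= 1 /\ code1 L y = j by [].
  rewrite /slab /= itv_boundlr /= !bnd_simp => /andP[->].
  by case: (_ < _)%N; rewrite bnd_simp // => /ltW.
have a0 : 0 <= a by rewrite divr_ge0.
have b1 : b <= 1 by rewrite ler_pdivrMr// mul1r ler_nat.
pose F := (`]a, b]%classic : set (measurableTypeR R)).
have mF : measurable F by exact: measurable_itv.
pose KB := markov_kernel (checkerboard N C); pose KC := markov_kernel C.
have mcube := @measurable_cube R d.
have Fmu : (\int[lebd]_(x in @cube R d) KC x F <= L.+1%:R^-1%:E)%E.
  rewrite -(markov_kernelP dmu (linkage_marginal linkC dmu))//; last first.
    by move=> t; rewrite /F /= !in_itv /= => /andP[/ltW/(le_trans a0) -> tb]; rewrite (le_trans tb).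
  apply: (@le_trans _ _ (mu [set t | F (tnth t ord_max)])).
    apply: le_measureW; first exact: measurable_tprod.
      by have := measurable_tnth (@ord_max d) measurableT mF; rewrite setTI.
    by move=> t [].
  rewrite (copula_margin dmu linkC.1)//.
  apply: (@le_trans _ _ (@lebesgue_measure R F)).
    by apply: le_measureW => //; exact: measurableI.
  rewrite lebesgue_measure_itv /= lte_fin; case: ifP => _; last by rewrite lee_fin invr_ge0 ltW.
  by rewrite -EFinB lee_fin /a /b -mulrBl -natrB// subSnn mul1r.
have mk (K : R.-pker (euclid R d) ~> measurableTypeR R) (u : R) :
    measurable_fun (@cube R d) (fun x => K x (ray u)).
  by apply: measurable_funTS; exact: measurable_kernel.
have mdist u : measurable_fun (@cube R d) (fun x => `|KB x (ray u) - KC x (ray u)|%E).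
  by apply: measurableT_comp => //; exact: emeasurable_funB.
apply: (@le_trans _ _ (\int[lebd]_(x in @cube R d) (`|KB x (ray a) - KC x (ray a)| +
    `|KB x (ray b) - KC x (ray b)| + KC x F))%E); last first.
  rewrite ge0_integralD//; last 3 first.
  - by move=> x _; exact: adde_ge0.
  - exact: emeasurable_funD.
  - by apply: measurable_funTS; exact: measurable_kernel.
  by rewrite ge0_integralD//; apply: leeD.
apply: ge0_le_integralW => x _ //.
have KS (K : R.-pker (euclid R d) ~> measurableTypeR R) (u v : R) : u <= v -> fine (K x (ray u)) <= fine (K x (ray v)).
  move=> uv; rewrite -lee_fin -!kernel_fineE//; apply: le_measureW => // t.
  by rewrite /= !in_itv /= => /andP[-> tu]; rewrite (le_trans tu).
have KF : fine (KC x (ray b)) <= fine (KC x (ray a)) + fine (KC x F).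
  rewrite -lee_fin EFinD -!kernel_fineE//.
  apply: le_trans (measureU2 _ _ _) => //; apply: le_measureW => //; first exact: measurableU.
  move=> t; rewrite /F /= !in_itv /= => /andP[-> ->] /=.
  by rewrite andbT; case: (leP t a) => _; [left|right].
have E (K : R.-pker (euclid R d) ~> measurableTypeR R) u : K x (ray u) = (fine (K x (ray u)))%:E.
  exact: kernel_fineE.
rewrite -/KB -/KC (E KB y) (E KC y) (E KB a) (E KC a) (E KB b) (E KC b).
rewrite (kernel_fineE KC x mF) -!EFinB -!EFinD lee_fin.
by apply: dist_monotone KF; rewrite ?KS.
Qed.

(** Finitely many grid levels have a common threshold, beyond which every y in [0, 1] satisfies the
    bound e/4 + e/4 + e/2 from [level_grid]. The outer integral runs over an interval of length 1
    and keeps the bound. *)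
Lemma D1_checkerboard_small (e : R) : 0 < e ->
  exists M0, forall M, (M0 <= M)%N -> (D1 (checkerboard M.+1 C) C <= e%:E)%E.
Proof.
move=> e0; have e40 : 0 < e / 4 by rewrite divr_gt0.
pose L := Num.truncn (2 / e).
have Le : L.+1%:R^-1 <= e / 2.
  rewrite -[e / 2]invrK lef_pV2 ?posrE ?invr_gt0 ?divr_gt0// invf_div.
  exact/ltW/truncnS_gt.
have grid01 (j : 'I_L.+2) : 0 <= (j%:R / L.+1%:R : R) <= 1.
  rewrite divr_ge0//= ler_pdivrMr ?ltr0n// mul1r ler_nat; exact: (ltn_ord j).
have /choice[M0 M0P] := fun j => level_cvg (grid01 j) e40.
exists (\sum_j M0 j)%N => M leM.
have lev (j : 'I_L.+2) : (level_distance M.+1 (j%:R / L.+1%:R) <= (e / 4)%:E)%E.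
  by apply: M0P; apply: leq_trans leM; rewrite (bigD1 j)//= leq_addr.
apply: (@le_trans _ _ (\int[@lebesgue_measure R]_(y in `[0%R, 1%R]) e%:E)%E).
  apply: ge0_le_integralW => y; first by move=> _; exact: integral_ge0.
  rewrite /= in_itv /= => y01.
  have [j lj] := level_grid M.+1 L y01.
  apply: (le_trans lj).
  have -> : e = e / 4 + e / 4 + e / 2 by field.
  rewrite !EFinD; apply: leeD; last by rewrite lee_fin.
  (* [widen_ord] and [lift ord0] select the levels j and j + 1 among the L + 2 grid levels, both
     endpoints included. *)
  apply: leeD; first exact: (lev (widen_ord (leqnSn _) j)).
  exact: (lev (lift ord0 j)).
by rewrite integral_cst//= lebesgue_itv01 mule1.
Qed.

End Convergence.

Theorem corollary4p13 (R : realType) (d : nat) (hd : (1 <= d)%N)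
    (C : euclid R d.+1 -> R) (hC : is_linkage C) :
  D1 (checkerboard N C) C @[N --> \oo] --> 0%E.
Proof.
have D0 N : (0 <= D1 (checkerboard N C) C)%E.
  by apply: integral_ge0 => y _; exact: integral_ge0.
apply/fine_cvgP; split.
  have [M0 M0P] := D1_checkerboard_small hC (@ltr01 R).
  (* A positive threshold discards N = 0, where there is no grid, and lets N be written as
     [M.+1]. *)
  exists M0.+1 => // -[//|M] /=; rewrite ltnS => /M0P leM.
  by rewrite ge0_fin_numE// (le_lt_trans leM)// ltry.
apply/cvgrPdist_le => e e0.
have [M0 M0P] := D1_checkerboard_small hC e0.
exists M0.+1 => // -[//|M] /=; rewrite ltnS => /M0P leM.
rewrite sub0r normrN ger0_norm ?fine_ge0// -lee_fin fineK//.
by rewrite ge0_fin_numE// (le_lt_trans leM)// ltry.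
Qed.
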